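(* Let $p\ge1$, $k\ge1$, $r\in\{0,\dots,p-1\}$, $q=p-r$, and suppose the model $(c,\{f_i\}_{i=0}^k)$ belongs to $\mathcal M_r$ (see context), with associated $\alpha,\mu,\theta,\chi,\psi$. Let $\mathscr M_\mu=\{z\in\mathbb R^p:\theta(z)=-\mu\}$. Let $N\subset\mathscr M_\mu$ be the set of $z\in\mathscr M_\mu$ at which $v\mapsto\chi^{-1}\begin{bmatrix}\psi(z)+v\\-\mu\end{bmatrix}$ is not differentiable at $v=0$, and $N_0$ the union of $N$ with the set of $z\in\mathscr M_\mu\setminus N$ at which the Jacobian of this map at $v=0$ is non-invertible. For $\mathfrak z\in\mathbb R^{kp}$ and $u\in\mathbb R^p$ let $z_\infty(u;\mathfrak z)=\lim_{t\to\infty}z_t(u;\mathfrak z)$, where $z_t(u;\mathfrak z)$ is as in the context. Then: (1) the full set of long-run multiplier matrices, i.e. the set of Jacobians $\partial_u z_\infty(u;\mathfrak z)|_{u=0}$ over all $\mathfrak z\in\mathbb R^{kp}$ at which this Jacobian exists, is $\{\Theta_\infty(z):z\in\mathscr M_\mu\setminus N\}$, where $$\Theta_\infty(z)\defeq\partial_u\left.\chi^{-1}\begin{bmatrix}\psi(z)+\alpha_\perp^\top u\\-\mu\end{bmatrix}\right|_{u=0}=\partial_v\left.\chi^{-1}\begin{bmatrix}\psi(z)+v\\-\mu\end{bmatrix}\right|_{v=0}\alpha_\perp^\top;$$ (2) $\operatorname{rank}\Theta_\infty(z)=q$ for every $z\in\mathscr M_\mu\setminus N_0$.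
   Context: Model: for $c\in\mathbb R^p$ and maps $f_0,\dots,f_k:\mathbb R^p\to\mathbb R^p$ with $f_i(0)=0$, the nonlinear VAR($k$) is $f_0(z_t)=c+\sum_{i=1}^k f_i(z_{t-i})+u_t$. (When $k=1$, blocks indexed by $1,\dots,k-1$ are empty.) Define $g_j(z)=-\sum_{i=j+1}^k f_i(z)$; $\pi(z)=-f_0(z)+\sum_{i=1}^k f_i(z)$; $\mathbf g(z)=(g_1(z)^\top,\dots,g_{k-1}(z)^\top)^\top$. $D\in\mathbb R^{p(k-1)\times p(k-1)}$ has $-I_p$ diagonal blocks, $I_p$ blocks immediately above the diagonal, zeros elsewhere; $E=(I_p,0_{p\times p(k-2)})^\top$. For $\alpha$ of rank $r$, $\alpha_\perp$ is $p\times q$ of rank $q$ with $\alpha_\perp^\top\alpha=0$; $\boldsymbol\alpha=\begin{bmatrix}\alpha & E^\top\\ 0 & I_{p(k-1)}\end{bmatrix}$; for $\theta:\mathbb R^p\to\mathbb R^r$, $\boldsymbol\theta(z)=(\theta(z)^\top,\mathbf g(z)^\top)^\top$, $\mathbf D_0=\begin{bmatrix}0_{r\times p}&0\\0&D\end{bmatrix}$. Joint spectral radius: $\rho_{JSR}(\mathcal A)=\limsup_{t}\sup\{\rho(M_1\cdots M_t)^{1/t}:M_s\in\mathcal A\}$. Class $\mathcal M_r$: the model belongs to $\mathcal M_r$ if for some $\alpha\in\mathbb R^{p\times r}$ of rank $r$, $\bar b<\infty$, $\bar\rho<1$: (i) $f_0$ is a homeomorphism of $\mathbb R^p$; (ii)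 there exist $\mu\in\mathbb R^r$, $\theta:\mathbb R^p\to\mathbb R^r$ with $c=\alpha\mu$, $\pi=\alpha\theta$; (iii) there is a closed $\mathcal B\subset\mathbb R^{kp\times[p(k-1)+r]}$ with $\max_{\mathcal B}\|\boldsymbol\beta\|\le\bar b$ and $\rho_{JSR}(\{I+\boldsymbol\beta^\top\boldsymbol\alpha:\boldsymbol\beta\in\mathcal B\})\le\bar\rho$, such that for all $\mathbf z=(z^\top,\boldsymbol\zeta^\top)^\top,\mathbf z'\in\mathbb R^{kp}$ some $\boldsymbol\beta\in\mathcal B$ satisfies $[\boldsymbol\theta(f_0^{-1}(z))+\mathbf D_0\mathbf z]-[\boldsymbol\theta(f_0^{-1}(z'))+\mathbf D_0\mathbf z']=\boldsymbol\beta^\top(\mathbf z-\mathbf z')$. Define $h(z)=f_0(z)-\sum_{i=1}^{k-1}g_i(z)$, $\psi=\alpha_\perp^\top h$, $\chi(z)=(\psi(z)^\top,\theta(z)^\top)^\top$ (a homeomorphism of $\mathbb R^p$). Impulse paths: for $\tau\in\mathbb N$, $\mathfrak z=(\mathfrak z_{(1)}^\top,\dots,\mathfrak z_{(k)}^\top)^\top\in\mathbb R^{kp}$ and $u\in\mathbb R^p$, $z_t(u;\mathfrak z)$ ($t\ge\tau$) is defined by $z_{\tau-i}=\mathfrak z_{(i)}$ and $f_0(z_t)=c+\sum_{i=1}^kf_i(z_{t-i})+u_t$ with $u_\tau=u$, $u_t=0$ for $t>\tau$. *)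

(* Defs.v *)
From HB Require Import structures.
From mathcomp Require Import all_boot all_order all_algebra.
From mathcomp Require Import all_classical all_reals all_analysis.
From mathcomp Require Import complex.
Set Implicit Arguments. Unset Strict Implicit. Unset Printing Implicit Defensive.
Import Order.TTheory GRing.Theory Num.Theory numFieldNormedType.Exports.
Local Open Scope classical_set_scope.
Local Open Scope ring_scope.

Section Defs.
Variable R : realType.

Definition cjacobian m n (f : 'cV[R]_n -> 'cV[R]_m) (x : 'cV[R]_n) : 'M[R]_(m, n) :=
  \matrix_(i, j) ('d f x (delta_mx j 0) i 0).

Definition homeomorphism n (f finv : 'cV[R]_n -> 'cV[R]_n) : Prop :=
  [/\ continuous f, continuous finv, cancel f finv & cancel finv f].

(* spectral radius: largest modulus of a complex eigenvalue (0 if none) *)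
Definition specrad n (M : 'M[R]_n) : R :=
  sup [set Num.sqrt (complex.Re l ^+ 2 + complex.Im l ^+ 2) | l in
        [set l : R[i] | root (char_poly (map_mx (real_complex R) M)) l]].

Fixpoint mxprods n (A : set 'M[R]_n) (t : nat) : set 'M[R]_n :=
  match t with
  | 0 => [set 1%:M]
  | t'.+1 => [set M *m P | M in A & P in mxprods A t']
  end.

Definition jsr n (A : set 'M[R]_n) : \bar R :=
  limn_esup (fun t : nat =>
    ereal_sup [set ((specrad M) `^ (t%:R^-1))%:E | M in mxprods A t]).

Section Model.
Variables (p k : nat) (f : nat -> 'cV[R]_p -> 'cV[R]_p).

Definition gfun (j : nat) (z : 'cV[R]_p) : 'cV[R]_p :=
  - \sum_(j.+1 <= i < k.+1) f i z.

Definition pifun (z : 'cV[R]_p) : 'cV[R]_p :=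
  - f 0 z + \sum_(1 <= i < k.+1) f i z.

(* the p(k-1) x p matrix placing a p-vector in block j (j = 0,...,k-2) *)
Definition blockE (j : nat) : 'M[R]_(p * (k - 1), p) :=
  \matrix_(a, b) ((a : nat) == (j * p + b)%N)%:R.

Definition Emx : 'M[R]_(p * (k - 1), p) := blockE 0.

(* D : -I_p diagonal blocks, I_p blocks immediately above the diagonal *)
Definition Dmx : 'M[R]_(p * (k - 1)) :=
  \matrix_(a, b) (- ((a : nat) == (b : nat))%:R + ((b : nat) == (a : nat) + p)%:R).

Definition bgfun (z : 'cV[R]_p) : 'cV[R]_(p * (k - 1)) :=
  \sum_(j < k - 1) blockE j *m gfun j.+1 z.

Definition hfun (z : 'cV[R]_p) : 'cV[R]_p :=
  f 0 z - \sum_(1 <= i < k) gfun i z.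

Variable r : nat.

Definition balpha (alpha : 'M[R]_(p, r)) : 'M[R]_(p + p * (k - 1), r + p * (k - 1)) :=
  block_mx alpha Emx^T 0 1%:M.

Definition btheta (theta : 'cV[R]_p -> 'cV[R]_r) (z : 'cV[R]_p) : 'cV[R]_(r + p * (k - 1)) :=
  col_mx (theta z) (bgfun z).

Definition bD0 : 'M[R]_(r + p * (k - 1), p + p * (k - 1)) :=
  block_mx 0 0 0 Dmx.

(* Membership in the class M_r, with the witnesses made explicit:
   alpha (rank r), mu, theta, the inverse f0inv of f_0, the set B,
   the bounds bbar and rhobar < 1. *)
Definition in_Mr (c : 'cV[R]_p) (alpha : 'M[R]_(p, r)) (mu : 'cV[R]_r)
    (theta : 'cV[R]_p -> 'cV[R]_r) (f0inv : 'cV[R]_p -> 'cV[R]_p)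
    (B : set 'M[R]_(p + p * (k - 1), r + p * (k - 1))) (bbar rhobar : R) : Prop :=
  [/\ \rank alpha = r /\ rhobar < 1,
      (* (i) *) homeomorphism (f 0) f0inv,
      (* (ii) *) c = alpha *m mu /\ (forall z, pifun z = alpha *m theta z),
      (* (iii) *) closed B /\ (forall beta, B beta -> `|beta| <= bbar) &
      (jsr [set (1%:M + beta^T *m balpha alpha)%R | beta in B] <= rhobar%:E)%E /\
      (forall bz bz' : 'cV[R]_(p + p * (k - 1)),
         exists2 beta, B beta &
           (btheta theta (f0inv (usubmx bz)) + bD0 *m bz)
           - (btheta theta (f0inv (usubmx bz')) + bD0 *m bz')
           = beta^T *m (bz - bz'))].

End Model.

Section Impulse.
Variables (p k : nat) (c : 'cV[R]_p) (f : nat -> 'cV[R]_p -> 'cV[R]_p)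
  (f0inv : 'cV[R]_p -> 'cV[R]_p).

(* Time is relabelled: step n corresponds to t = tau + n.
   zwin zz u n j = z_{tau+n-1-j}; initially z_{tau-1-j} = zz j (= frak z_(j+1)).
   z_t = f_0^{-1}(c + sum_{i=1}^k f_i(z_{t-i}) + u_t), u_tau = u, u_t = 0 after. *)
Fixpoint zwin (zz : 'I_k -> 'cV[R]_p) (u : 'cV[R]_p) (n : nat) : nat -> 'cV[R]_p :=
  match n with
  | 0 => fun j => oapp zz 0 (insub j)
  | n'.+1 => fun j =>
      if j is j'.+1 then zwin zz u n' j'
      else f0inv (c + \sum_(i < k) f i.+1 (zwin zz u n' i)
                    + (if n' == 0%N then u else 0))
  end.

Definition zpath (zz : 'I_k -> 'cV[R]_p) (u : 'cV[R]_p) (n : nat) : 'cV[R]_p :=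
  zwin zz u n.+1 0.

Definition zinf (zz : 'I_k -> 'cV[R]_p) (u : 'cV[R]_p) : 'cV[R]_p :=
  limn (zpath zz u).

Definition lr_jacobian_exists (zz : 'I_k -> 'cV[R]_p) : Prop :=
  (\forall u \near (0 : 'cV[R]_p), cvgn (zpath zz u)) /\
  differentiable (zinf zz) 0.

End Impulse.

End Defs.

(* Main.v *)
Require Import Defs.
From HB Require Import structures.
From mathcomp Require Import all_boot all_order all_algebra.
From mathcomp Require Import all_classical all_reals all_analysis.
From mathcomp Require Import complex.
From mathcomp Require Import perm ring lra.
Set Implicit Arguments.
Unset Strict Implicit.
Import Order.TTheory GRing.Theory Num.Theory numFieldNormedType.Exports.
Local Open Scope classical_set_scope.
Local Open Scope ring_scope.

(* Stack the lags into the state [Z = (f_0(z); zeta)]. With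
   [E = (mu; 0) + theta(z) + D_0 Z], past the impact date the model reads
   [Z' = Z + balpha E], and class M_r gives [E' = (I + beta^T balpha) E] for some
   beta in B. The bound on the joint spectral radius is stated through spectral
   radii, so a form of the Berger-Wang theorem is needed to make products of these
   matrices decay geometrically. Then Z converges and E vanishes in the limit, so
   [theta(z_oo) = - mu] and the limit is a steady state, while
   [alpha_perp^T (f_0(z) - zeta_1)] is constant along the path after the impulse
   and equals [psi] at a steady state. Hence
   [z_oo(u) = chi^-1(a + alpha_perp^T u; - mu)] where [a] depends only on the
   initial window and is [psi(z)] for the constant window [z] in M_mu; since
   alpha_perp^T is onto, differentiability in [u] and in [v = alpha_perp^T u] agree.

   Berger-Wang, by induction on the dimension: if the products do not decay
   geometrically, rescale so that the growth rate is exactly 1, and let V be the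
   space of vectors with bounded orbits. If V is proper and nonzero the matrices are
   simultaneously block triangular; if V = 0 the growth rate exceeds 1; if V is
   everything, some orbit nearly returns, producing an eigenvalue near 1. *)

(** * The largest-entry norm on matrices *)

Section MatrixNorm.
Variable R : realType.

Lemma normmx_entry m n (M : 'M[R]_(m, n)) i j : `|M i j| <= `|M|.
Proof.
rewrite [leRHS]/Num.norm /= mx_normrE; apply/bigmax_geP; right => /=.
by exists (i, j).
Qed.

Lemma normmx_le m n (M : 'M[R]_(m, n)) (c : R) :
  0 <= c -> (forall i j, `|M i j| <= c) -> `|M| <= c.
Proof.
move=> c0 Mc; rewrite [leLHS]/Num.norm /= mx_normrE.
by apply/bigmax_leP; split.
Qed.

(** This norm is not submultiplicative: each product costs the inner dimension, a factor that recurs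
    in the constants below. *)
Lemma normmxM m n p (M : 'M[R]_(m, n)) (N : 'M[R]_(n, p)) :
  `|M *m N| <= n%:R * `|M| * `|N|.
Proof.
apply: normmx_le => [|i j]; first by rewrite !mulr_ge0.
rewrite mxE (le_trans (ler_norm_sum _ _ _))//.
rewrite -mulrA -[n in n%:R]card_ord mulr_natl -sumr_const ler_sum// => l _.
by rewrite normrM ler_pM// normmx_entry.
Qed.

Lemma normmxM3 m n p q (M : 'M[R]_(m, n)) (N : 'M[R]_(n, p)) (P : 'M[R]_(p, q)) :
  `|M *m N *m P| <= n%:R * p%:R * `|M| * `|P| * `|N|.
Proof.
rewrite (le_trans (normmxM _ _))//.
rewrite (@le_trans _ _ (p%:R * (n%:R * `|M| * `|N|) * `|P|))//.
  by rewrite ler_wpM2r// ler_wpM2l// normmxM.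
rewrite le_eqVlt; apply/orP; left; apply/eqP; ring.
Qed.

Lemma normmx_tr m n (M : 'M[R]_(m, n)) : `|M^T| = `|M|.
Proof.
have le_tr k l (N : 'M[R]_(k, l)) : `|N^T| <= `|N|.
  by apply: normmx_le => // i j; rewrite mxE normmx_entry.
by apply/eqP; rewrite eq_le le_tr -[leLHS](congr1 _ (trmxK M)) le_tr.
Qed.

End MatrixNorm.

(** * Products of matrices from a set and their geometric growth *)

Section Products.
Variable R : realType.
Implicit Types (n s t : nat).

Lemma mxprodsD n (A : set 'M[R]_n) s t P Q :
  mxprods A s P -> mxprods A t Q -> mxprods A (s + t) (P *m Q).
Proof.
elim: s P => [|s IHs] P /=; first by move=> -> AQ; rewrite mul1mx.
move=> [M AM [P' AP' <-]] AQ; exists M => //; exists (P' *m Q); first exact: IHs.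
by rewrite mulmxA.
Qed.

Lemma mxprods_split n (A : set 'M[R]_n) s t P : mxprods A (s + t) P ->
  exists P1 P2, [/\ mxprods A s P1, mxprods A t P2 & P = P1 *m P2].
Proof.
elim: s P => [|s IHs] P /=.
  by move=> AP; exists 1%:M, P; split=> //; rewrite mul1mx.
move=> [M AM [P' /IHs[P1 [P2 [AP1 AP2 ->]]] <-]].
exists (M *m P1), P2; split=> //; first by exists M => //; exists P1.
by rewrite mulmxA.
Qed.

(** Names the factors of one long product, so that any window of consecutive factors can be handled
    as a product of its own. *)
Fixpoint iprod n (m : nat -> 'M[R]_n) (i l : nat) : 'M[R]_n :=
  if l is l'.+1 then m i *m iprod m i.+1 l' else 1%:M.

Lemma iprodD n (m : nat -> 'M[R]_n) i s t :
  iprod m i (s + t) = iprod m i s *m iprod m (i + s) t.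
Proof.
elim: s i => [|s IHs] i /=; first by rewrite mul1mx addn0.
by rewrite IHs mulmxA addSnnS.
Qed.

Lemma iprod_mxprods n (A : set 'M[R]_n) (m : nat -> 'M[R]_n) i l :
  (forall j, (i <= j < i + l)%N -> A (m j)) -> mxprods A l (iprod m i l).
Proof.
elim: l i => [|l IHl] i Am //=.
exists (m i); first by apply: Am; rewrite leqnn addnS ltnS leq_addr.
exists (iprod m i.+1 l) => //; apply: IHl => j /andP[ij jl].
by apply: Am; rewrite (ltnW ij) addnS -addSn.
Qed.

Lemma mxprods_iprod n (A : set 'M[R]_n) t P : mxprods A t P ->
  exists2 m : nat -> 'M[R]_n, (forall j, (j < t)%N -> A (m j)) &
    P = iprod m 0 t.
Proof.
elim: t P => [|t IHt] P /=; first by move=> ->; exists (fun=> 0).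
move=> [M AM [P' /IHt[m Am ->] <-]].
pose m' j := if j is j'.+1 then m j' else M.
exists m' => [[|j]|]; [by []|exact: Am|].
suff shift l i : iprod m i l = iprod m' i.+1 l by rewrite /= -shift.
by elim: l i => //= l IHl i; rewrite IHl.
Qed.

Definition grow n (A : set 'M[R]_n) (g : R) :=
  exists C, forall t P, mxprods A t P -> `|P| <= C * g ^+ t.

Lemma grow_le n (A : set 'M[R]_n) g h : 0 <= g -> g <= h -> grow A g -> grow A h.
Proof.
move=> g0 gh [C AC]; exists C => t P AP; apply: (le_trans (AC _ _ AP)).
have [C0|C0] := leP 0 C; first by rewrite ler_wpM2l// lerXn2r// nnegrE (le_trans g0).
have := le_trans (normr_ge0 _) (AC _ _ AP).
have [->|gt0] := eqVneq (g ^+ t) 0; last first.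
  by rewrite nmulr_rge0// => gle; have := exprn_ge0 t g0; rewrite le0r (negbTE gt0) /= ltNge gle.
(* The empty product forces [C >= 0]. *)
have := AC 0 1%:M erefl; rewrite expr0 mulr1 => /(le_trans (normr_ge0 _)).
by rewrite leNgt C0.
Qed.

Lemma grow_bounded n (A : set 'M[R]_n) (b : R) :
  0 <= b -> (forall M, A M -> `|M| <= b) -> grow A (n%:R * b + 1).
Proof.
move=> b0 Ab; exists `|1%:M : 'M[R]_n|; elim=> [|t IHt] P /=.
  by move=> ->; rewrite expr0 mulr1.
move=> [M /Ab Mb [Q /IHt AQ <-]]; apply: (le_trans (normmxM _ _)).
rewrite exprS mulrCA ler_pM ?mulr_ge0//.
by rewrite (@le_trans _ _ (n%:R * b)) ?lerDl// ler_wpM2l.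
Qed.

Definition stable n (A : set 'M[R]_n) := exists2 g : R, 0 < g < 1 & grow A g.

(** Cut a product into blocks of length [T]: each block halves the bound, and the leftover, shorter
    than [T], is controlled by [grow_bounded]. The factor [n] in the hypothesis absorbs the one in
    [normmxM]. *)
Lemma stable_of_power n (A : set 'M[R]_n) (b : R) T :
  0 <= b -> (forall M, A M -> `|M| <= b) ->
  (0 < T)%N -> (forall P, mxprods A T P -> n%:R * `|P| <= 2^-1) -> stable A.
Proof.
move=> b0 Ab T0 AT.
have [C AC] := grow_bounded b0 Ab.
set h : R := 2^-1.
have h0 : 0 < h by rewrite invr_gt0 ltr0n.
pose g : R := h `^ (T%:R^-1).
have gT : g ^+ T = h.
  by rewrite -powR_mulrn ?powR_ge0// -powRrM mulVf ?pnatr_eq0 -?lt0n// powRr1// ltW.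
have g0 : 0 < g by exact: powR_gt0.
have g1 : g < 1.
  rewrite ltNge; apply/negP => g1.
  by have := exprn_ege1 T g1; rewrite gT /h; lra.
exists g; first by rewrite g0.
pose L := n%:R * b + 1.
have L1 : 1 <= L by rewrite lerDr mulr_ge0.
have C0 : 0 <= C.
  have := AC 0 1%:M erefl; rewrite expr0 mulr1.
  exact: le_trans.
(* [C * L ^+ T] bounds the leftover factors; dividing by [g ^+ T] pays for the steps that do not
   complete a block. *)
exists (C * L ^+ T / g ^+ T).
have step : forall q s P, (s < T)%N -> mxprods A (q * T + s) P ->
    `|P| <= C * L ^+ T * h ^+ q.
  elim=> [|q IHq] s P sT.
    rewrite mul0n add0n expr0 mulr1 => /AC/le_trans; apply.
    by rewrite ler_wpM2l// -/L ler_weXn2l// ltnW.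
  rewrite mulSn -addnA => /mxprods_split[P1 [P2 [/AT P1h /(IHq _ _ sT) P2q ->]]].
  by apply: (le_trans (normmxM _ _)); rewrite exprS mulrCA ler_pM// ?mulr_ge0.
move=> t P; rewrite {1}(divn_eq t T) => /(step _ _ _ (ltn_pmod t T0))/le_trans; apply.
rewrite -[leRHS]mulrA ler_wpM2l ?mulr_ge0 ?exprn_ge0 ?(le_trans _ L1)//.
have -> : g ^+ t = h ^+ (t %/ T) * g ^+ (t %% T).
  by rewrite {1}(divn_eq t T) exprD mulnC exprM gT.
rewrite mulrCA ler_peMr ?exprn_ge0 ?(ltW h0)// mulrC ler_pdivlMr ?exprn_gt0// mul1r.
by rewrite ler_wiXn2l ?(ltW g0) ?(ltW g1)// ltnW// ltn_pmod.
Qed.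

End Products.

(** * Eigenvalues, determinants and almost fixed vectors *)

Section Spectrum.
Variable R : realType.
Local Notation C := (R[i]).
Local Notation toC := (real_complex R).

(** This form, without [t]-th roots, passes to diagonal blocks and to scalings by positive factors
    at most 1, as the induction requires. *)
Definition spec_le n (A : set 'M[R]_n) (T : nat) (rho : R) :=
  forall t P, (T <= t)%N -> mxprods A t P ->
  forall l : C, eigenvalue (map_mx toC P) l -> `|l| <= toC rho.

Lemma horner_char_poly (F : comNzRingType) n (M : 'M[F]_n) (a : F) :
  (char_poly M).[a] = \det (a%:M - M).
Proof.
rewrite -horner_evalE -det_map_mx; congr (\det _); apply/matrixP => i j.
by rewrite !mxE /= /horner_eval !hornerE ?hornerMn ?hornerX.
Qed.

(** Over the complex numbers the determinant is the product of [1 - l] over the eigenvalues [l],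
    each factor having modulus at least [1 - rho]. *)
Lemma det_sub1_ge n (P : 'M[R]_n) rho : rho < 1 ->
  (forall l : C, eigenvalue (map_mx toC P) l -> `|l| <= toC rho) ->
  (1 - rho) ^+ n <= `|\det (1%:M - P)|.
Proof.
move=> rho1 Prho.
have [s] := closed_field_poly_normal (char_poly (map_mx toC P)).
rewrite (monicP (char_poly_monic _)) scale1r => Es.
have sz : size s = n.
  by have := size_char_poly (map_mx toC P); rewrite Es size_prod_XsubC => -[].
have normC x : `|toC x| = toC `|x|.
  by rewrite normc_def /= expr0n addr0 sqrtr_sqr.
suff: toC ((1 - rho) ^+ n) <= toC `|\det (1%:M - P)| by rewrite lecR.
rewrite -normC -det_map_mx map_mxB map_mx1 -horner_char_poly Es horner_prod.
rewrite normr_prod rmorphXn rmorphB rmorph1 -sz -[size s]card_ord.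
rewrite (big_nth 0) big_mkord -prodr_const ler_prod// => i _.
rewrite hornerXsubC subr_ge0 lecR (ltW rho1)/=.
have /Prho lerho : eigenvalue (map_mx toC P) s`_i.
  by rewrite eigenvalue_root_char Es root_prod_XsubC mem_nth.
rewrite lerBlDr (le_trans _ (lerD (lexx _) lerho))//.
by rewrite (le_trans _ (ler_normD _ _))// subrK normr1.
Qed.

Lemma det_norm_le n (M : 'M[R]_n) : `|\det M| <= n`!%:R * `|M| ^+ n.
Proof.
rewrite (le_trans (ler_norm_sum _ _ _))//.
rewrite mulr_natl -card_Sn -sumr_const ler_sum// => s _.
rewrite normrM normrX normrN1 expr1n mul1r normr_prod.
have -> : `|M| ^+ n = \prod_(i < n) `|M| by rewrite prodr_const card_ord.
by rewrite ler_prod// => i _; rewrite normr_ge0 normmx_entry.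
Qed.

Lemma adj_norm_le n (M : 'M[R]_n) : `|\adj M| <= n.-1`!%:R * `|M| ^+ n.-1.
Proof.
apply: normmx_le => [|i j]; first by rewrite mulr_ge0// exprn_ge0.
rewrite mxE normrM normrX normrN1 expr1n mul1r.
apply: (le_trans (det_norm_le _)); rewrite ler_wpM2l// lerXn2r ?nnegrE//.
by apply: normmx_le => // a b; rewrite !mxE normmx_entry.
Qed.

(** Multiplying [x - x P] by the adjugate of [1 - P] gives the determinant times [x]. An almost
    fixed vector thus makes the determinant small, against [det_sub1_ge]. *)
Lemma det_sub1_small n (P : 'M[R]_n) (x : 'rV[R]_n) :
  `|\det (1%:M - P)| * `|x| <=
  n%:R * `|x *m P - x| * (n.-1`!%:R * (1 + `|P|) ^+ n.-1).
Proof.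
have -> : `|\det (1%:M - P)| * `|x| = `|(x - x *m P) *m \adj (1%:M - P)|.
  have -> : x - x *m P = x *m (1%:M - P) by rewrite mulmxBr mulmx1.
  by rewrite -mulmxA mul_mx_adj mul_mx_scalar normrZ.
rewrite (le_trans (normmxM _ _))// distrC ler_wpM2l ?mulr_ge0//.
rewrite (le_trans (adj_norm_le _))// ler_wpM2l// lerXn2r ?nnegrE ?addr_ge0//.
rewrite (le_trans (ler_normB _ _))// lerD2r.
apply: normmx_le => // i j; rewrite mxE; case: (i == j) => /=;
 by rewrite ?normr1 ?normr0.
Qed.

(** Cut the cube of radius [K] into cells of side [e]; [N] is the number of cells, so two of [N + 1]
    points share one. *)
Lemma pigeonhole n (K e : R) : 0 < e -> exists N, forall x : nat -> 'rV[R]_n,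
  (forall i, (i <= N)%N -> `|x i| <= K) ->
  exists i j, [/\ (i < j)%N, (j <= N)%N & `|x j - x i| <= e].
Proof.
move=> e0.
pose m := Num.truncn (2 * K / e).
pose N := #|{: {ffun 'I_n -> 'I_m.+1}}|; exists N => x xK.
pose code (i : 'I_N.+1) : {ffun 'I_n -> 'I_m.+1} :=
  [ffun l => inord (Num.truncn ((x i 0 l + K) / e))].
have : ~~ injectiveb code.
  apply/negP => /injectiveP/leq_card; rewrite card_ord.
  by rewrite ltnn.
have far i j : code i = code j -> `|x j - x i| <= e.
  move=> /ffunP cij; apply: normmx_le => [|a l]; first exact: ltW.
  have xl (u : 'I_N.+1) : 0 <= (x u 0 l + K) / e /\ (Num.truncn ((x u 0 l + K) / e)%R < m.+1)%N.
    have := le_trans (normmx_entry (x u) 0 l) (xK _ (leq_ord u)).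
    rewrite ler_norml => /andP[lo hi].
    split; first by rewrite divr_ge0 ?(ltW e0)//; lra.
    by rewrite ltnS; apply: Num.Theory.le_truncn; rewrite ler_pM2r ?invr_gt0//; lra.
  have [ci Ci] := xl i; have [cj Cj] := xl j.
  have := cij l; rewrite !ffunE => /(congr1 val); rewrite /= !inordK// => E.
  have /andP[lo1 hi1] := Num.Theory.truncn_itv ci.
  have /andP[] := Num.Theory.truncn_itv cj; rewrite -E => lo2 hi2.
  rewrite !mxE (ord1 a) ler_norml.
  have -> : x j 0 l - x i 0 l = ((x j 0 l + K) / e - (x i 0 l + K) / e) * e.
    by field; rewrite gt_eqF.
  rewrite -[X in _ <= _ <= X]mul1r -mulN1r !ler_pM2r//.
  by move: lo1 hi1 lo2 hi2; rewrite -!natr1 => *; apply/andP; split; lra.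
move=> /injectivePn[i [j ij /far cij]].
have [lt|lt|E] := ltngtP i j.
- by exists i, j; rewrite lt leq_ord.
- by exists j, i; rewrite lt leq_ord distrC.
- by rewrite (val_inj E) eqxx in ij.
Qed.

End Spectrum.

(** * The Berger-Wang theorem *)

Section BergerWang.
Variable R : realType.
Local Notation toC := (real_complex R).

Lemma geometric_small (g C e : R) : 0 <= g < 1 -> 0 < e ->
  \forall i \near \oo, C * g ^+ i <= e.
Proof.
move=> /andP[g0 g1] e0.
have /cvgrPdist_le/(_ _ e0) : (fun i => C * g ^+ i) @ \oo --> (0 : R).
  by apply: cvg_geometric; rewrite ger0_norm.
by apply: filterS => i; rewrite sub0r normrN; apply: le_trans (ler_norm _).
Qed.

(* A long product that is not small yields an orbit staying in a fixed shell;
   two of its points are close, so the product in between nearly fixes a vector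
   and has an eigenvalue near 1. *)
Lemma stable_of_grow1 n (A : set 'M[R]_n) (b : R) T rho :
  0 <= b -> (forall M, A M -> `|M| <= b) -> 0 <= rho < 1 ->
  spec_le A T rho -> grow A 1 -> stable A.
Proof.
move=> b0 Ab /andP[rho0 rho1] Arho [K0 AK0].
have [K K1 AK] : exists2 K, 1 <= K & forall t P, mxprods A t P -> `|P| <= K.
  exists (`|K0| + 1) => [|t P /AK0]; first by rewrite lerDr.
  by rewrite expr1n mulr1 => /le_trans; apply; rewrite (le_trans (ler_norm _))// lerDl.
case: n A Ab Arho AK0 AK => [|n] A Ab Arho _ AK.
  exists 2^-1; first by rewrite invr_gt0 invf_lt1 ?ltr0n ?ltr1n.
  by exists 0 => t P _; rewrite mul0r; apply: normmx_le => // -[].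
pose N0 : R := n.+1%:R.
have N0_ge1 : 1 <= N0 by rewrite ler1n.
have N0_gt0 : 0 < N0 by rewrite (lt_le_trans ltr01).
have K0gt0 : 0 < K by rewrite (lt_le_trans ltr01).
(* [c] will bound the orbit from below, [delta] the determinant from below and [D] the adjugate term
   from above; [e] makes [N0 * e * D] half of [delta * c]. *)
pose c : R := (2 * N0 * N0 * K)^-1.
have c0 : 0 < c by rewrite invr_gt0 !mulr_gt0// (lt_le_trans ltr01).
pose D : R := n`!%:R * (1 + K) ^+ n.
have D0 : 0 < D by rewrite mulr_gt0 ?ltr0n ?fact_gt0// exprn_gt0// ltr_wpDl// (lt_le_trans ltr01).
pose delta := (1 - rho) ^+ n.+1.
have delta0 : 0 < delta by rewrite exprn_gt0// subr_gt0.
pose e := delta * c / (2 * N0 * D).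
have e0 : 0 < e by apply: divr_gt0; apply: mulr_gt0 => //; exact: mulr_gt0.
have [N xN] := pigeonhole n.+1 K e0.
(* Sampling the orbit every [L] steps makes each product between two sampled points long enough for
   [spec_le]. *)
pose L := T.+1.
apply: contrapT => nst.
have [P AP Pbig] : exists2 P, mxprods A (N.+1 * L)%N P & 2^-1 < N0 * `|P|.
  apply: contrapT => noP; apply: nst; apply: (@stable_of_power _ _ _ b (N.+1 * L)%N) => //.
  by move=> P AP; rewrite leNgt; apply/negP => ?; apply: noP; exists P.
have [m Am Pm] := mxprods_iprod AP.
have [j Pj] : exists j, 2^-1 < N0 * `|(delta_mx 0 j : 'rV[R]_n.+1) *m P|.
  apply: contrapT => noj; move: Pbig; apply/negP; rewrite -leNgt.
  rewrite -ler_pdivlMl ?(lt_le_trans ltr01)//; apply: normmx_le.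
    by rewrite mulr_ge0// invr_ge0 (le_trans ler01).
  move=> i j; rewrite ler_pdivlMl ?(lt_le_trans ltr01)// leNgt; apply/negP => ij.
  apply: noj; exists i; rewrite (lt_le_trans ij)// ler_wpM2l ?(le_trans ler01)//.
  by rewrite -rowE; have := normmx_entry (row i P) 0 j; rewrite mxE.
pose Q i := iprod m 0 (i * L).
pose x i : 'rV[R]_n.+1 := delta_mx 0 j *m Q i.
have AQ i : (i <= N.+1)%N -> mxprods A (i * L) (Q i).
  by move=> iN; apply: iprod_mxprods => l /andP[_ lt]; apply: Am;
    rewrite (leq_trans lt)// leq_mul2r iN orbT.
have Dj : `|delta_mx 0 j : 'rV[R]_n.+1| <= 1.
  by apply: normmx_le => // a l; rewrite mxE; case: (_ && _); rewrite ?normr1 ?normr0.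
have xK i : (i <= N)%N -> `|x i| <= K.
  move=> iN; rewrite /x -rowE; apply: normmx_le => [|a l]; first by rewrite (le_trans ler01).
  rewrite mxE (le_trans (normmx_entry _ _ _))// (AK (i * L)%N)//.
  by apply: AQ; exact: leqW.
have Qcat i l : (i + l <= N.+1)%N ->
    exists2 S, mxprods A (l * L) S & Q (i + l)%N = Q i *m S.
  move=> ilN; exists (iprod m (i * L) (l * L)); last by rewrite /Q mulnDl iprodD add0n.
  apply: iprod_mxprods => a /andP[_ lt]; apply: Am; rewrite (leq_trans lt)//.
  by rewrite -mulnDl leq_mul2r ilN orbT.
(* The orbit ends with norm above [1 / (2 N0)] and the remaining factors multiply to norm at most
   [K], so it was never below [c]. *)
have xc i : (i <= N)%N -> c <= `|x i|.
  move=> iN; have iN1 : (i + (N.+1 - i) = N.+1)%N by rewrite subnKC// leqW.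
  have [S AS ES] := Qcat i (N.+1 - i)%N (eq_leq iN1).
  rewrite iN1 in ES.
  have QP : Q N.+1 = P by rewrite Pm.
  have := ltW Pj; rewrite -QP ES mulmxA -/(x i) => h.
  have := le_trans h (ler_wpM2l (le_trans ler01 N0_ge1) (normmxM _ _)).
  move=> {}h; have {}h : 2^-1 <= N0 * (N0 * `|x i| * K).
    rewrite (le_trans h)// ler_wpM2l ?(ltW N0_gt0)// ler_wpM2l ?mulr_ge0//.
    exact: AK AS.
  rewrite /c -div1r ler_pdivrMr ?mulr_gt0//.
  have -> : `|x i| * (2 * N0 * N0 * K) = 2 * (N0 * (N0 * `|x i| * K)).
    by clearbody N0; clear; ring.
  by rewrite -ler_pdivrMl// mulr1.
have [i [k [ik kN xik]]] := xN x xK.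
have ikE : (i + (k - i) = k)%N by rewrite subnKC// ltnW.
have ikN : (i + (k - i) <= N.+1)%N by rewrite ikE leqW.
have [S AS ES] := Qcat i (k - i)%N ikN.
rewrite ikE in ES.
have xS : x k = x i *m S by rewrite /x ES mulmxA.
have dS : delta <= `|\det (1%:M - S)|.
  apply: det_sub1_ge => //; apply: (Arho _ _ _ AS).
  by rewrite (leq_trans (leqnSn T))// -/L -[leqLHS]mul1n leq_mul2r subn_gt0 ik orbT.
have := det_sub1_small S (x i); rewrite -xS /= leNgt => /negP; apply.
apply: (@lt_le_trans _ _ (delta * c)); last first.
  by apply: ler_pM => //; [exact: ltW|exact: ltW|exact: xc (leq_trans (ltnW ik) kN)].
have SK : n`!%:R * (1 + `|S|) ^+ n <= D.
  by rewrite ler_wpM2l// lerXn2r ?nnegrE ?addr_ge0 ?(le_trans ler01 K1)// lerD2l (AK _ _ AS).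
apply: (@le_lt_trans _ _ (N0 * e * D)).
  by rewrite ler_pM ?mulr_ge0 ?exprn_ge0 ?addr_ge0// ler_wpM2l.
rewrite /e.
have -> : N0 * (delta * c / (2 * N0 * D)) * D = delta * c / 2.
  by field; rewrite !gt_eqF// (lt_le_trans ltr01).
by rewrite ltr_pdivrMr// ltr_pMr ?mulr_gt0// ltr1n.
Qed.

(* By compactness of the sphere every vector at least doubles within a bounded
   number of steps, which exceeds every growth rate close enough to 1. *)
Lemma unbounded_orbits_growth n (A : set 'M[R]_n.+1) :
  (forall x : 'rV[R]_n.+1, x != 0 ->
     forall K, exists t P, mxprods A t P /\ K < `|x *m P|) ->
  exists2 s, 1 < s & ~ grow A s.
Proof.
move=> unb.
pose S1 : set 'rV[R]_n.+1 := [set x | `|x| = 1].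
have cS1 : compact S1.
  apply: bounded_closed_compact.
    by exists 1; split=> // y y1 x /= ->; exact: ltW.
  have -> : S1 = (fun x => `|x|) @^-1` [set 1] by [].
  by apply: preimage_closed => [x _|]; [exact: norm_continuous|exact: closed_eq].
have [L Ldbl] : exists L, forall x, S1 x ->
    exists t P, [/\ (t <= L)%N, mxprods A t P & 2 < `|x *m P|].
  have /compact_near_coveringP/(_ nat \oo
    (fun L x => exists t P, [/\ (t <= L)%N, mxprods A t P & 2 < `|x *m P|]) _) := cS1.
  case=> [x Sx|L _ /(_ L (leqnn L))]; last by exists L.
  have x0 : x != 0 by rewrite -normr_gt0 Sx.
  have [t [P [AP P2]]] := unb x x0 2.
  (* Within distance [d] of [x] the same product [P] still reaches norm above 2. *)
  pose d := (`|x *m P| - 2) / (n.+1%:R * (`|P| + 1)).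
  have d0 : 0 < d by rewrite divr_gt0 ?subr_gt0// mulr_gt0// ltr_wpDl.
  near=> y L => /=; exists t, P; split=> //; first by near: L; exists t.
  have xy : `|x - y| < d by near: y; apply/nbhs_ballP; exists d => //= z; rewrite mx_norm_ball.
  have := normmxM (x - y) P.
  have h : n.+1%:R * `|x - y| * `|P| < `|x *m P| - 2.
    rewrite (@le_lt_trans _ _ (n.+1%:R * `|x - y| * (`|P| + 1)))// ?ler_wpM2l ?mulr_ge0 ?lerDl//.
    by rewrite mulrAC mulrC -ltr_pdivlMr// mulr_gt0// ltr_wpDl.
  move=> /le_lt_trans/(_ h); rewrite mulmxBl => xyP.
  have := lerB_dist (x *m P) (y *m P); lra.
(* Any [h] strictly between 1 and 2 would do: norms double within [L + 1] steps, while rate [s]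
   allows only the factor [h]. *)
have [h hE] : exists h : R, h = 3 / 2 by exists (3 / 2).
pose s := h `^ L.+1%:R^-1.
have h1 : 1 < h by rewrite hE; lra.
have sL : s ^+ L.+1 = h.
  by rewrite -powR_mulrn ?powR_ge0// -powRrM mulVf// powRr1// hE; lra.
have s1 : 1 < s.
  rewrite ltNge; apply/negP => s1.
  by have := exprn_ile1 L.+1 (powR_ge0 _ _) s1; rewrite -/s sL hE; lra.
exists s => // -[C AC].
pose x0 : 'rV[R]_n.+1 := const_mx 1.
have x01 : S1 x0.
  apply/eqP; rewrite eq_le; apply/andP; split.
    by apply: normmx_le => // i j; rewrite mxE normr1.
  by have := normmx_entry x0 0 0; rewrite mxE normr1.
have big i : exists t P, [/\ (t <= i * L.+1)%N, mxprods A t P & 2 ^+ i <= `|x0 *m P|].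
  elim: i => [|i [t [P [tL AP Pi]]]].
    by exists 0%N, 1%:M; split=> //; rewrite mulmx1 x01.
  pose y := x0 *m P.
  have y0 : 0 < `|y| by rewrite (lt_le_trans _ Pi)// exprn_gt0.
  have [|t' [P' [t'L AP' P'2]]] := Ldbl (`|y|^-1 *: y).
    by rewrite /S1/= normrZ normfV normr_id mulVf// gt_eqF.
  exists (t + t')%N, (P *m P'); split.
  - by rewrite mulSn addnC leq_add// leqW.
  - exact: mxprodsD.
  rewrite mulmxA -/y exprS.
  move: P'2; rewrite -scalemxAl normrZ normfV normr_id ltr_pdivlMl// => /ltW.
  by apply: le_trans; rewrite mulrC ler_wpM2r.
have [i _ /(_ i (leqnn i))] : \forall i \near \oo, (n.+1%:R * C) * (3 / 4) ^+ i <= 2^-1.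
  by apply: geometric_small; lra.
have [t [P [tL AP Pi]]] := big i.
have C0 : 0 <= C.
  by have := AC 0%N 1%:M erefl; rewrite expr0 mulr1; exact: le_trans.
have : 2 ^+ i <= n.+1%:R * C * h ^+ i.
  rewrite (le_trans Pi)// (le_trans (normmxM _ _))// x01 mulr1 -mulrA ler_wpM2l//.
  rewrite (le_trans (AC _ _ AP))// ler_wpM2l// -sL -exprM mulnC.
  by rewrite ler_weXn2l// ltW.
have -> : (3 / 4 : R) = h / 2 by rewrite hE; lra.
rewrite expr_div_n mulrA ler_pdivrMr ?exprn_gt0// => h2 h3.
have := le_trans h2 h3; rewrite ler_pMl ?exprn_gt0//; lra.
Unshelve. all: by end_near. Qed.

(** Choose [U] of maximal rank among the matrices whose row space lies in [V]; adding a further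
    vector of [V] cannot raise the rank. *)
Lemma subspace_mx n (V : set 'rV[R]_n) :
  V 0 -> (forall a x y, V x -> V y -> V (a *: x + y)) ->
  exists U : 'M[R]_n, forall x, V x <-> (x <= U)%MS.
Proof.
move=> V0 Vlin.
pose Q m := `[< exists2 U : 'M[R]_n, (forall x, (x <= U)%MS -> V x) & \rank U = m >].
have exQ : exists m, Q m.
  by exists 0%N; apply/asboolP; exists 0; rewrite ?mxrank0// => x; rewrite submx0 => /eqP ->.
have ubQ m : Q m -> (m <= n)%N by move=> /asboolP[U _ <-]; exact: rank_leq_row.
have [m /asboolP[U UV rU] maxm] := ex_maxnP exQ ubQ.
exists U => x; split=> [Vx|]; last exact: UV.
have xU : (U <= U + x)%MS := addsmxSl U x.
apply: (submx_trans (addsmxSr U x)).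
rewrite -(mxrank_leqif_sup xU); rewrite eqn_leq mxrankS//= rU.
apply: maxm; apply/asboolP; exists (U + x)%MS => // y /sub_addsmxP[[u v] ->] /=.
have -> : u *m U + v *m x = v 0 0 *: x + u *m U.
  by rewrite addrC -mul_scalar_mx -mx11_scalar.
by apply: Vlin => //; apply: UV; exact: submxMl.
Qed.

(** * Simultaneous block triangular form *)

Section Block.
Variables (n m m' : nat) (U : 'M[R]_(m, n)) (W : 'M[R]_(m', n)).
Variables (U' : 'M[R]_(n, m)) (W' : 'M[R]_(n, m')).
Hypotheses (UU' : U *m U' = 1%:M) (UW' : U *m W' = 0).
Hypotheses (WW' : W *m W' = 1%:M) (splitI : U' *m U + W' *m W = 1%:M).
Variable A : set 'M[R]_n.
Hypothesis AU : forall M, A M -> U *m M *m W' = 0.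

(** Block multiplication, by inserting [splitI] between the factors. [U M U'] and [W M W'] are the
    diagonal blocks, [W M U'] is the surviving corner, and [AU] kills the other one. *)
Let decomp (P Q : 'M[R]_n) k l (X : 'M[R]_(k, n)) (Y : 'M[R]_(n, l)) :
  X *m (P *m Q) *m Y =
  X *m P *m U' *m (U *m Q *m Y) + X *m P *m W' *m (W *m Q *m Y).
Proof.
rewrite -[P in LHS]mulmx1 -splitI !(mulmxDr, mulmxDl) !mulmxA.
by [].
Qed.

Lemma block_prods0 t P : mxprods A t P -> U *m P *m W' = 0.
Proof.
elim: t P => [|t IHt] P /=; first by move=> ->; rewrite mulmx1.
move=> [M AM [Q /IHt AQ <-]].
by rewrite decomp (AU AM) mul0mx addr0 AQ mulmx0.
Qed.

Let A1 := [set U *m M *m U' | M in A].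
Let A2 := [set W *m M *m W' | M in A].

Lemma block_prods1 t P : mxprods A t P -> mxprods A1 t (U *m P *m U').
Proof.
elim: t P => [|t IHt] P /=; first by move=> ->; rewrite mulmx1.
move=> [M AM [Q AQ <-]]; exists (U *m M *m U'); first by exists M.
exists (U *m Q *m U'); first exact: IHt.
by rewrite decomp (AU AM) mul0mx addr0.
Qed.

Lemma block_prods2 t P : mxprods A t P -> mxprods A2 t (W *m P *m W').
Proof.
elim: t P => [|t IHt] P /=; first by move=> ->; rewrite mulmx1.
move=> [M AM [Q AQ <-]]; exists (W *m M *m W'); first by exists M.
exists (W *m Q *m W'); first exact: IHt.
by rewrite decomp (block_prods0 AQ) mulmx0 add0r.
Qed.

Lemma block_prods1V t Q : mxprods A1 t Q ->
  exists2 P, mxprods A t P & Q = U *m P *m U'.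
Proof.
elim: t Q => [|t IHt] Q /=; first by move=> ->; exists 1%:M; rewrite ?mulmx1.
move=> [_ [M AM <-] [_ /IHt[P AP ->] <-]].
exists (M *m P); first by exists M => //; exists P.
by rewrite decomp (AU AM) mul0mx addr0.
Qed.

Lemma block_prods2V t Q : mxprods A2 t Q ->
  exists2 P, mxprods A t P & Q = W *m P *m W'.
Proof.
elim: t Q => [|t IHt] Q /=; first by move=> ->; exists 1%:M; rewrite ?mulmx1.
move=> [_ [M AM <-] [_ /IHt[P AP ->] <-]].
exists (M *m P); first by exists M => //; exists P.
by rewrite decomp (block_prods0 AP) mulmx0 add0r.
Qed.

(** A left eigenvector [v] of the block lifts to [v U], because [U P = (U P U') U]. *)
Lemma spec_block1 T rho : spec_le A T rho -> spec_le A1 T rho.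
Proof.
move=> Arho t _ Tt /block_prods1V[P AP ->] l /eigenvalueP[v vE v0].
apply: (Arho t P Tt AP); apply/eigenvalueP; exists (v *m map_mx toC U).
  have UP : U *m P = U *m P *m U' *m U.
    by rewrite -[LHS]mulmx1 -splitI mulmxDr !mulmxA (block_prods0 AP) mul0mx addr0.
  by rewrite -mulmxA -map_mxM UP map_mxM mulmxA vE scalemxAl.
apply: contra v0 => /eqP vU0; apply/eqP.
by rewrite -[v]mulmx1 -(map_mx1 toC) -UU' map_mxM mulmxA vU0 mul0mx.
Qed.

(** Here the intertwining [P W' = W' (W P W')] acts on the right, so eigenvectors are lifted for the
    transposes. *)
Lemma spec_block2 T rho : spec_le A T rho -> spec_le A2 T rho.
Proof.
move=> Arho t _ Tt /block_prods2V[P AP ->] l.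
have eigT k (M : 'M[R[i]]_k) a : eigenvalue M a = eigenvalue M^T a.
  rewrite !eigenvalue_root_char; congr (root _ a).
  rewrite /char_poly -det_tr; congr (\det _).
  by rewrite /char_poly_mx linearB /= tr_scalar_mx map_trmx.
rewrite eigT => /eigenvalueP[v vE v0].
apply: (Arho t P Tt AP); rewrite eigT; apply/eigenvalueP.
exists (v *m (map_mx toC W')^T).
  have PW : P *m W' = W' *m (W *m P *m W').
    by rewrite -[LHS]mul1mx -splitI mulmxDl -!mulmxA [U *m _]mulmxA (block_prods0 AP) mulmx0 add0r.
  by rewrite -mulmxA -trmx_mul -map_mxM PW map_mxM trmx_mul mulmxA vE scalemxAl.
apply: contra v0 => /eqP vW0; apply/eqP.
rewrite -[v]mulmx1 -trmx1 -(map_mx1 toC) -WW' map_mxM trmx_mul mulmxA vW0.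
by rewrite mul0mx.
Qed.

(** The corner of a product [Q Q'] is a sum of two terms, each a corner times a diagonal block.
    Diagonal blocks decay, so for long products doubling the length halves the bound on the
    corner. *)
Lemma stable_block (b : R) : 0 <= b -> (forall M, A M -> `|M| <= b) ->
  stable A1 -> stable A2 -> stable A.
Proof.
move=> b0 Ab [g1 /andP[g10 g11] A1g] [g2 /andP[g20 g21] A2g].
pose g := Num.max g1 g2.
have g01 : 0 < g < 1 by rewrite lt_max g10 gt_max g11 g21.
have /andP[g0 _] := g01.
have g1g : g1 <= g by rewrite le_max lexx.
have g2g : g2 <= g by rewrite le_max lexx orbT.
have [C1 A1C] := grow_le (ltW g10) g1g A1g.
have [C2 A2C] := grow_le (ltW g20) g2g A2g.
pose C := Num.max C1 C2.
have PC1 t P : mxprods A t P -> `|U *m P *m U'| <= C * g ^+ t.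
  move=> /block_prods1/(A1C _)/le_trans; apply.
  by rewrite ler_wpM2r ?exprn_ge0 ?(ltW g0)// le_max lexx.
have PC2 t P : mxprods A t P -> `|W *m P *m W'| <= C * g ^+ t.
  move=> /block_prods2/(A2C _)/le_trans; apply.
  by rewrite ler_wpM2r ?exprn_ge0 ?(ltW g0)// le_max lexx orbT.
have C0 : 0 <= C.
  by have := PC1 0%N 1%:M erefl; rewrite expr0 mulr1; exact: le_trans.
(* Beyond length [N] the diagonal decay beats the factor [2 (m + m') C] of the doubling step. *)
have [N _ Ns] : \forall i \near \oo, (2 * (m + m')%:R * C) * g ^+ i <= 1.
  by apply: geometric_small => //; rewrite (ltW g0); have /andP[] := g01.
pose s := N.+1.
have [K AK] := grow_bounded b0 Ab.
(* The crude bound on the corner at length [s], where the doubling starts. *)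
pose B := n%:R * n%:R * `|W| * `|U'| * (K * (n%:R * b + 1) ^+ s).
have PB i P : mxprods A (2 ^ i * s) P -> `|W *m P *m U'| <= B * 2^-1 ^+ i.
  elim: i P => [|i IHi] P.
    rewrite mul1n expr0 mulr1 => /AK PK; apply: (le_trans (normmxM3 _ _ _)).
    by rewrite ler_wpM2l// !mulr_ge0.
  rewrite expnS mul2n -addnn mulnDl => /mxprods_split[Q [Q' [AQ AQ' ->]]].
  rewrite decomp; set t := (2 ^ i * s)%N in AQ AQ' *.
  have QB := IHi _ AQ; have QB' := IHi _ AQ'.
  set beta := B * 2^-1 ^+ i in QB QB' *.
  have Nt : (N <= t)%N by rewrite (leq_trans (leqnSn N))// leq_pmull// expn_gt0.
  have := Ns t Nt; rewrite natrD => Nst.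
  apply: (le_trans (ler_normD _ _)).
  apply: (@le_trans _ _ (m%:R * beta * (C * g ^+ t) + m'%:R * (C * g ^+ t) * beta)).
    apply: lerD; apply: (le_trans (normmxM _ _)).
      by rewrite ler_pM ?mulr_ge0// ?PC1// ler_wpM2l.
    by rewrite ler_pM ?mulr_ge0// ler_wpM2l// PC2.
  have beta0 : 0 <= beta by exact: le_trans QB.
  have -> : B * 2^-1 ^+ i.+1 = 2^-1 * beta by rewrite exprS mulrCA.
  apply: (@le_trans _ _ (2^-1 * beta * (2 * (m%:R + m'%:R) * C * g ^+ t))).
    by rewrite le_eqVlt; apply/orP; left; apply/eqP; field.
  by rewrite ler_piMr// mulr_ge0// invr_ge0.
pose D1 := m%:R * m%:R * `|U'| * `|U|.
pose D2 := m'%:R * m'%:R * `|W'| * `|W|.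
pose D3 := m'%:R * m%:R * `|W'| * `|U|.
have PD P t : mxprods A t P ->
    `|P| <= D1 * `|U *m P *m U'| + D3 * `|W *m P *m U'| + D2 * `|W *m P *m W'|.
  move=> AP.
  have EP : P = U' *m (U *m P *m U') *m U + W' *m (W *m P *m U') *m U
              + W' *m (W *m P *m W') *m W.
    have UP : U *m P = U *m P *m U' *m U.
      by rewrite -[LHS]mulmx1 -splitI mulmxDr !mulmxA (block_prods0 AP) mul0mx addr0.
    rewrite -[LHS]mul1mx -splitI mulmxDl -addrA; congr (_ + _).
      by rewrite -mulmxA {1}UP !mulmxA.
    by rewrite -[P in LHS]mulmx1 -splitI !mulmxDr !mulmxA.
  rewrite {1}EP; apply: (le_trans (ler_normD _ _)); apply: lerD; last exact: normmxM3.
  by apply: (le_trans (ler_normD _ _)); apply: lerD; exact: normmxM3.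
(* At length [2 ^ i * s] the diagonal and the corner contribute at most 1/4 each, within the 1/2 of
   [stable_of_power]. *)
near \oo => i.
have s0 : (0 < 2 ^ i * s)%N by rewrite muln_gt0 expn_gt0.
apply: (stable_of_power b0 Ab s0) => P AP.
have PDi := PD _ _ AP.
have PBi := PB _ _ AP.
have gi : C * g ^+ (2 ^ i * s) <= C * g ^+ i.
  rewrite ler_wpM2l// ler_wiXn2l ?(ltW g0)//; first by have /andP[_ /ltW] := g01.
  by rewrite (leq_trans (ltnW (ltn_expl i (ltnSn 1))))// leq_pmulr.
have P1i := le_trans (PC1 _ _ AP) gi.
have P2i := le_trans (PC2 _ _ AP) gi.
have small1 : n%:R * (D1 + D2) * C * g ^+ i <= 4^-1.
  near: i; apply: geometric_small; last by rewrite invr_gt0.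
  by rewrite (ltW g0); have /andP[] := g01.
have small2 : n%:R * D3 * B * 2^-1 ^+ i <= 4^-1.
  near: i; apply: geometric_small; last by rewrite invr_gt0.
  by rewrite invr_ge0 ler0n invf_lt1 ?ltr0n// ltr1n.
apply: (@le_trans _ _ (n%:R * (D1 + D2) * C * g ^+ i + n%:R * D3 * B * 2^-1 ^+ i)).
  apply: (@le_trans _ _ (n%:R * (D1 * (C * g ^+ i) + D3 * (B * 2^-1 ^+ i) + D2 * (C * g ^+ i)))).
    by rewrite ler_wpM2l// (le_trans PDi)// !lerD// ler_wpM2l// !mulr_ge0.
  by rewrite le_eqVlt; apply/orP; left; apply/eqP; ring.
by apply: (le_trans (lerD small1 small2)); lra.
Unshelve. all: by end_near. Qed.

End Block.

(** * Rescaling to critical growth *)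

Section Scaling.
Variables (n : nat) (A : set 'M[R]_n) (c : R).
Hypothesis c0 : 0 < c.
Let cA := [set c *: M | M in A].

Lemma mxprods_scale t P : mxprods A t P -> mxprods cA t (c ^+ t *: P).
Proof.
elim: t P => [|t IHt] P /=; first by move=> ->; rewrite expr0 scale1r.
move=> [M AM [Q /IHt AQ <-]]; exists (c *: M); first by exists M.
by exists (c ^+ t *: Q) => //; rewrite -scalemxAl -scalemxAr scalerA exprS.
Qed.

Lemma mxprods_scaleV t Q : mxprods cA t Q ->
  exists2 P, mxprods A t P & Q = c ^+ t *: P.
Proof.
elim: t Q => [|t IHt] Q /=; first by move=> ->; exists 1%:M; rewrite ?expr0 ?scale1r.
move=> [_ [M AM <-] [_ /IHt[P AP ->] <-]].
exists (M *m P); first by exists M => //; exists P.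
by rewrite -scalemxAl -scalemxAr scalerA exprS.
Qed.

Lemma grow_scale g : grow cA g <-> grow A (g / c).
Proof.
split=> -[C AC]; exists C => t P.
  move=> /mxprods_scale/AC; rewrite normrZ ger0_norm ?exprn_ge0 ?(ltW c0)//.
  by rewrite expr_div_n mulrA ler_pdivlMr ?exprn_gt0// mulrC.
move=> /mxprods_scaleV[Q /AC AQ ->].
rewrite normrZ ger0_norm ?exprn_ge0 ?(ltW c0)// mulrC -ler_pdivlMr ?exprn_gt0//.
by rewrite -mulrA -expr_div_n.
Qed.

Lemma spec_scale T rho : c <= 1 -> 0 <= rho -> spec_le A T rho -> spec_le cA T rho.
Proof.
move=> c1 rho0 Arho t _ Tt /mxprods_scaleV[P AP ->] l /eigenvalueP[v vE v0].
pose k := toC (c ^+ t).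
have k0 : k != 0 by rewrite fmorph_eq0 expf_neq0// gt_eqF.
have kE : `|k| = k.
  by rewrite ger0_norm// ler0c exprn_ge0// ltW.
have /(Arho t P Tt AP) lk : eigenvalue (map_mx toC P) (l / k).
  apply/eigenvalueP; exists v => //.
  rewrite mulrC -scalerA -vE map_mxZ -scalemxAr scalerA mulVf// scale1r.
  by [].
have -> : `|l| = `|l / k| * k by rewrite normrM normfV kE divfK.
rewrite (le_trans (ler_wpM2r _ lk))//; first by rewrite -kE.
rewrite -rmorphM lecR ler_piMr// exprn_ile1// ltW//.
Qed.

End Scaling.

(** Divide by the infimum of the admissible growth rates, which is at least 1 because [A] is not
    stable. *)
Lemma critical_scaling n (A : set 'M[R]_n) (b : R) :
  0 <= b -> (forall M, A M -> `|M| <= b) -> ~ stable A ->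
  exists c, [/\ 0 < c, c <= 1, ~ stable [set c *: M | M in A] &
    forall s, 1 < s -> grow [set c *: M | M in A] s].
Proof.
move=> b0 Ab nst.
pose E := [set g : R | 0 < g /\ grow A g].
have E1 : lbound E 1.
  move=> g [g0 Ag]; rewrite leNgt; apply/negP => g1; apply: nst.
  by exists g; rewrite ?g0.
have infE : has_inf E.
  split; last by exists 1.
  exists (n%:R * b + 1); split; last exact: grow_bounded.
  by rewrite ltr_wpDl// mulr_ge0.
have i1 : 1 <= inf E by exact: lb_le_inf infE.1 E1.
have i0 : 0 < inf E by exact: lt_le_trans i1.
have c0 : 0 < (inf E)^-1 by rewrite invr_gt0.
exists (inf E)^-1; split=> //; first by rewrite invf_le1.
- move=> [g /andP[g0 g1] /(grow_scale _ c0)]; rewrite invrK => Ag.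
  have /(ge_inf infE.2) : E (g * inf E) by split=> //; exact: mulr_gt0.
  by rewrite ler_pMl// leNgt g1.
- move=> s s1; apply/(grow_scale _ c0); rewrite invrK.
  have [|e [e0 Ae] es] := @inf_lt R E (s * inf E) infE.1; first by rewrite ltr_pMl.
  exact: grow_le (ltW e0) (ltW es) Ae.
Qed.

Theorem berger_wang n (A : set 'M[R]_n) (b : R) T (rho : R) :
  0 <= b -> (forall M, A M -> `|M| <= b) -> 0 <= rho < 1 ->
  spec_le A T rho -> stable A.
Proof.
have [N] := ubnP n; elim: N => // N IHN in n A b T rho *.
rewrite ltnS => nN b0 Ab rho01 Arho; apply: contrapT => nstA.
have [c [c0 c1 nst cgrow]] := critical_scaling b0 Ab nstA.
have {nstA} := spec_scale c0 c1 (proj1 (andP rho01)) Arho.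
have {Ab b0} : exists2 b', 0 <= b' & forall M, [set c *: M | M in A] M -> `|M| <= b'.
  exists (c * b) => [|_ [M /Ab Mb <-]]; first by rewrite mulr_ge0// ltW.
  by rewrite normrZ gtr0_norm// ler_pM2l.
move: {c A c0 c1 Arho} [set c *: M | M in A] nst cgrow => A nst cgrow [{}b b0 Ab] Arho.
case: n A b nN nst cgrow b0 Ab Arho => [|n] A b nN nst cgrow b0 Ab Arho.
  apply: nst; exists 2^-1; first by rewrite invr_gt0 ltr0n invf_lt1 ?ltr0n// ltr1n.
  by exists 0 => t P _; rewrite mul0r; apply: normmx_le => // -[].
pose V := [set x : 'rV[R]_n.+1 | exists K, forall t P, mxprods A t P -> `|x *m P| <= K].
have V0 : V 0 by exists 0 => t P _; rewrite mul0mx normr0.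
have Vlin a x y : V x -> V y -> V (a *: x + y).
  move=> [K xK] [L yL]; exists (`|a| * K + L) => t P AP.
  rewrite mulmxDl (le_trans (ler_normD _ _))// -scalemxAl lerD//; last exact: yL AP.
  by rewrite normrZ ler_wpM2l//; exact: xK AP.
have [U UV] := subspace_mx V0 Vlin.
have VM x M : V x -> A M -> V (x *m M).
  move=> [K xK] AM; exists K => t P AP; rewrite -mulmxA.
  by apply: (xK t.+1); exists M => //; exists P.
(* If [V = 0], every nonzero vector has an unbounded orbit, so growth exceeds some rate above 1,
   against criticality. *)
have [U0|Upos] := posnP (\rank U).
  have [x x0 K|s s1 /(_ (cgrow s s1))//] := @unbounded_orbits_growth _ A.
  apply: contrapT => bnd.
  have /UV : V x.
    by exists K => t P AP; rewrite leNgt; apply/negP => ?; apply: bnd; exists t, P.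
  have -> : U = 0 by apply/eqP; rewrite -mxrank_eq0 U0.
  by rewrite submx0 (negbTE x0).
(* If [V] is everything, the orbit bounds of the basis vectors bound all products. *)
have [Un|Un] := eqVneq (\rank U) n.+1.
  apply: nst; apply: (stable_of_grow1 b0 Ab rho01 Arho).
  have Vall x : V x by apply/UV; rewrite submx_full// /row_full Un.
  have [K AK] := choice (fun j : 'I_n.+1 => Vall (delta_mx 0 j)).
  exists (\sum_j `|K j|) => t P AP; rewrite expr1n mulr1.
  apply: normmx_le => [|i j]; first by rewrite sumr_ge0.
  rewrite (bigD1 i)//= ler_wpDr ?sumr_ge0//.
  have := le_trans (le_trans (normmx_entry _ 0 j) (AK i t P AP)) (ler_norm _).
  by rewrite -rowE mxE.
have Ult : (\rank U < n.+1)%N by rewrite ltn_neqAle Un rank_leq_row.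
(* Stack a basis of [V] on one of a complement; the two halves of the inverse supply [U'] and [W'],
   and invariance of [V] gives the zero corner. *)
pose U1 := row_base U; pose W := row_base U^C%MS.
pose G := col_mx U1 W; pose G' := pinvmx G.
have rG : \rank G = n.+1.
  rewrite -(addsmxE U1 W).
  rewrite (adds_eqmx (eq_row_base U) (eq_row_base U^C%MS)).
  by apply/eqP; exact: addsmx_compl_full.
have GG' : G *m G' = 1%:M.
  by apply: mulmxVp; rewrite /row_free rG mxrank_compl subnKC// ltnW.
have G'G : G' *m G = 1%:M by apply: mulVpmx; rewrite /row_full rG.
rewrite -(hsubmxK G') mul_col_row scalar_mx_block in GG'.
rewrite -(hsubmxK G') mul_row_col in G'G.
have [UU' UW' _ WW'] := eq_block_mx GG'.
have AU M : A M -> U1 *m M *m rsubmx G' = 0.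
  move=> AM; have /submxP[X ->] : (U1 *m M <= U1)%MS.
    apply/row_subP => i; rewrite row_mul eq_row_base; apply/UV; apply: VM AM.
    by apply/UV; rewrite (submx_trans (row_sub i U1))// eq_row_base.
  by rewrite -mulmxA UW' mulmx0.
have bounded_conj k (X : 'M[R]_(k, n.+1)) (Y : 'M[R]_(n.+1, k)) M :
    A M -> `|X *m M *m Y| <= n.+1%:R * n.+1%:R * `|X| * `|Y| * b.
  by move=> AM; rewrite (le_trans (normmxM3 _ _ _))// ler_wpM2l ?mulr_ge0// Ab.
apply: nst; apply: (stable_block UU' UW' WW' G'G AU b0 Ab).
  apply: (IHN _ _ (n.+1%:R * n.+1%:R * `|U1| * `|lsubmx G'| * b) T rho) => //.
  - exact: leq_trans Ult nN.
  - by rewrite !mulr_ge0.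
  - by move=> _ [M AM <-]; exact: bounded_conj.
  - exact: (spec_block1 UU' UW' G'G AU Arho).
apply: (IHN _ _ (n.+1%:R * n.+1%:R * `|W| * `|rsubmx G'| * b) T rho) => //.
- by rewrite mxrank_compl (leq_trans _ nN)// ltn_subrL Upos (leq_trans Upos (ltnW Ult)).
- by rewrite !mulr_ge0.
- by move=> _ [M AM <-]; exact: bounded_conj.
- exact: (spec_block2 UW' WW' G'G AU Arho).
Qed.

End BergerWang.

(** * From the joint spectral radius to eigenvalue bounds *)

Section JointSpectralRadius.
Variable R : realType.
Local Notation toC := (real_complex R).

Lemma eigenvalue_le_specrad n (P : 'M[R]_n) (l : R[i]) :
  eigenvalue (map_mx toC P) l -> `|l| <= toC (specrad P).
Proof.
rewrite eigenvalue_root_char => Pl; rewrite normc_def lecR.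
apply: ub_le_sup; last by exists l.
have [s] := closed_field_poly_normal (char_poly (map_mx toC P)).
rewrite (monicP (char_poly_monic _)) scale1r => Es.
pose m (z : R[i]) := Num.sqrt (complex.Re z ^+ 2 + complex.Im z ^+ 2).
(* [sup] dominates its set only when the set is bounded above; the sum of the moduli of the finitely
   many roots is a bound. *)
exists (\sum_(z <- s) m z) => _ [z /= + <-]; rewrite Es root_prod_XsubC => zs.
by rewrite (big_rem z)//= lerDl sumr_ge0// => ? _; exact: sqrtr_ge0.
Qed.

(** A limit superior below [rho] gives [specrad P <= rho ^+ t] for all long products, and
    [rho ^+ t <= rho] once [t > 0]. *)
Lemma jsr_spec_le n (A : set 'M[R]_n) (rhobar : R) :
  rhobar < 1 -> (jsr A <= rhobar%:E)%E ->
  exists T, exists2 rho, 0 <= rho < 1 & spec_le A T rho.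
Proof.
move=> rhobar1 jA.
(* The midpoint of [rhobar] and 1, raised to 0 in case it is negative. *)
pose rho := Num.max 0 ((rhobar + 1) / 2).
have rho0 : 0 <= rho by rewrite le_max lexx.
have rho1 : rho < 1 by rewrite gt_max ltr01/=; lra.
have : (jsr A < rho%:E)%E.
  by rewrite (le_lt_trans jA)// lte_fin lt_max; apply/orP; right; lra.
move=> /ereal_inf_lt[_ [V [N _ NV] <-] Vrho].
exists N.+1, rho => [|t P Nt AP l Pl]; first by rewrite rho0.
have t0 : (0 < t)%N by exact: leq_ltn_trans Nt.
have Pl' := eigenvalue_le_specrad Pl.
have P0 : 0 <= specrad P by rewrite -(ler0c) (le_trans _ Pl').
rewrite (le_trans Pl')// lecR.
have : specrad P `^ t%:R^-1 <= rho.
  rewrite -lee_fin (le_trans _ (ltW Vrho))//.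
  apply: (@le_trans _ _ (ereal_sup [set (specrad M `^ t%:R^-1)%:E | M in mxprods A t])).
    by apply: ereal_sup_ubound; exists P.
  by apply: ereal_sup_ubound; exists t => //; apply: NV; exact: ltnW.
have Pt : (specrad P `^ t%:R^-1) ^+ t = specrad P.
  by rewrite -powR_mulrn ?powR_ge0// -powRrM mulVf ?pnatr_eq0 -?lt0n// powRr1.
move=> Prho; rewrite -Pt (@le_trans _ _ (rho ^+ t))//.
  by rewrite lerXn2r// nnegrE powR_ge0.
by case: t t0 {Nt AP Pt Prho} => // t _; rewrite exprS ler_piMr// exprn_ile1// ltW.
Qed.

End JointSpectralRadius.

(** * The stacked lags *)

Section Blocks.
Variables (R : realType) (p k : nat).
Local Notation bE := (@blockE R p k).

Lemma blockET_row m (M : 'M[R]_(p * (k - 1), m)) (b : 'I_(p * (k - 1))) j (a : 'I_p) l :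
  b = (j * p + a)%N :> nat -> ((bE j)^T *m M) a l = M b l.
Proof.
move=> bja; rewrite mxE (bigD1 b)//= big1 => [|i ib].
  by rewrite !mxE bja eqxx mul1r addr0.
by rewrite !mxE -bja (inj_eq val_inj) (negbTE ib) mul0r.
Qed.

Lemma block_index j (a : 'I_p) : (j < k - 1)%N -> (j * p + a < p * (k - 1))%N.
Proof.
move=> jk; rewrite (@leq_trans (j.+1 * p))// ?mulSn; first by rewrite addnC ltn_add2r.
by rewrite -mulSn mulnC leq_mul2l jk orbT.
Qed.

Lemma block_eq m (M N : 'M[R]_(p * (k - 1), m)) :
  (forall j, (j < k - 1)%N -> (bE j)^T *m M = (bE j)^T *m N) -> M = N.
Proof.
move=> MN; apply/matrixP => b l.
have p0 : (0 < p)%N by case: (p) b => // -[].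
have bE : b = (b %/ p * p + Ordinal (ltn_pmod b p0))%N :> nat by rewrite -divn_eq.
by rewrite -!(blockET_row _ _ bE) MN// ltn_divLR// [X in (_ < X)%N]mulnC.
Qed.

Lemma blockE_orth i j : (i < k - 1)%N ->
  (bE i)^T *m bE j = if i == j then 1%:M else 0.
Proof.
move=> ik; apply/matrixP => a b.
rewrite (@blockET_row _ _ (Ordinal (block_index a ik)))// mxE /=.
have p0 : (0 < p)%N by case: (p) a => // -[].
have -> : (i * p + a == j * p + b)%N = (i == j) && (a == b).
  apply/eqP/andP => [E|[/eqP-> /eqP->]//].
  have := congr1 (divn^~ p) E; rewrite !divnMDl// !divn_small// !addn0 => <-; split=> //.
  by move/(congr1 (modn^~ p)): E; rewrite !modnMDl !modn_small// => /val_inj ->.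
by case: (i == j); rewrite !mxE.
Qed.

(** Since the block just past the end vanishes, the last block row of [D] obeys the same formula as
    the others. *)
Lemma blockE_over j : (k - 1 <= j)%N -> bE j = 0.
Proof.
move=> kj; apply/matrixP => b a; rewrite !mxE.
suff -> : (b == j * p + a :> nat)%N = false by [].
apply/eqP => E; have := ltn_ord b; rewrite E ltnNge mulnC => /negP; apply.
by rewrite (leq_trans _ (leq_addr _ _))// leq_mul2r kj orbT.
Qed.

Lemma blockET_D j : (j < k - 1)%N ->
  (bE j)^T *m Dmx R p k = - (bE j)^T + (bE j.+1)^T.
Proof.
move=> jk; apply/matrixP => a b.
rewrite (@blockET_row _ _ (Ordinal (block_index a jk)))// !mxE /=.
have -> : (j.+1 * p + a = j * p + a + p)%N by rewrite mulSn -addnA addnC.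
by rewrite (eq_sym (j * p + a)%N).
Qed.

Lemma sum_blockET_D : (\sum_(j < k - 1) (bE j)^T) *m Dmx R p k = - (Emx R p k)^T.
Proof.
rewrite mulmx_suml (eq_bigr (fun j : 'I_(k - 1) => (bE j.+1)^T - (bE j)^T)).
  rewrite -(big_mkord xpredT (fun j => (bE j.+1)^T - (bE j)^T)) telescope_sumr//.
  by rewrite blockE_over// trmx0 sub0r.
by move=> j _; rewrite blockET_D// addrC.
Qed.

Variable f : nat -> 'cV[R]_p -> 'cV[R]_p.
Local Notation g := (gfun k f).

Lemma blockET_bgfun j z : (j < k - 1)%N -> (bE j)^T *m bgfun k f z = g j.+1 z.
Proof.
move=> jk; rewrite /bgfun mulmx_sumr (bigD1 (Ordinal jk))//= big1 => [|i ij].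
  by rewrite mulmxA blockE_orth// eqxx mul1mx addr0.
rewrite mulmxA blockE_orth// ifN ?mul0mx//.
by apply: contra ij => /eqP E; apply/eqP/val_inj.
Qed.

Lemma sum_blockET_bgfun z :
  (\sum_(j < k - 1) (bE j)^T) *m bgfun k f z = \sum_(1 <= i < k) g i z.
Proof.
have -> : \sum_(1 <= i < k) g i z = \sum_(j < k - 1) g j.+1 z.
  by rewrite big_add1 big_mkord subn1.
by rewrite mulmx_suml; apply: eq_bigr => j _; exact: blockET_bgfun.
Qed.

Lemma f_gfun i z : (i < k)%N -> f i.+1 z = g i.+1 z - g i z.
Proof.
move=> ik; by rewrite /gfun opprK addrC [X in X - _]big_ltn// addrK.
Qed.

Lemma gfunk z : g k z = 0.
Proof. by rewrite /gfun big_geq// oppr0. Qed.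

(* The lag window [w], newest value first, enters the stacked state through
   [zeta_(j+1) = sum_(j < i < k) g_i (w (i - j))]. *)
Definition lagsum (w : nat -> 'cV[R]_p) (j : nat) : 'cV[R]_p :=
  \sum_(j.+1 <= i < k) g i (w (i - j)%N).

Definition zeta (w : nat -> 'cV[R]_p) : 'cV[R]_(p * (k - 1)) :=
  \sum_(j < k - 1) bE j *m lagsum w j.

Lemma blockET_zeta w j : (j <= k - 1)%N -> (bE j)^T *m zeta w = lagsum w j.
Proof.
rewrite leq_eqVlt => /predU1P[->|jk].
  (* At [j = k - 1] both sides vanish; for [k = 1] this is the case [j = 0] used later. *)
  by rewrite blockE_over// trmx0 mul0mx /lagsum big_geq// subn1 leqSpred.
rewrite /zeta mulmx_sumr (bigD1 (Ordinal jk))//= big1 => [|i ij].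
  by rewrite mulmxA blockE_orth// eqxx mul1mx addr0.
rewrite mulmxA blockE_orth// ifN ?mul0mx//.
by apply: contra ij => /eqP E; apply/eqP/val_inj.
Qed.

Lemma lagsum_shift (w w' : nat -> 'cV[R]_p) j : (forall i, w' i.+1 = w i) ->
  (j < k - 1)%N -> lagsum w' j = g j.+1 (w 0) + lagsum w j.+1.
Proof.
move=> w'w jk; have jk1 : (j.+1 < k)%N by move: jk; rewrite ltn_subRL.
rewrite /lagsum big_ltn// subSnn w'w; congr (_ + _).
by apply: eq_big_nat => i /andP[ji _]; rewrite -(subnSK (ltnW ji)) w'w.
Qed.

(** [D] is the block shift minus the identity, so adding [zeta w] leaves the shifted blocks plus the
    new terms [g_(j+1) (w 0)]. *)
Lemma zeta_shift (w w' : nat -> 'cV[R]_p) : (forall i, w' i.+1 = w i) ->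
  zeta w' = zeta w + (bgfun k f (w 0) + Dmx R p k *m zeta w).
Proof.
move=> w'w; apply: block_eq => j jk.
rewrite !mulmxDr blockET_bgfun// mulmxA blockET_D// mulmxDl mulNmx.
rewrite !blockET_zeta// 1?ltnW//.
by rewrite (lagsum_shift w'w jk) [RHS]addrCA addNKr.
Qed.

(** Summation by parts with [f_gfun]: the [g_(i+1)] form the lag sum of the new window, the [g_i]
    that of the old one, and the leftover [- g_0] equals [f_0 + pi]. *)
Lemma sum_f_lagsum (w w' : nat -> 'cV[R]_p) : (0 < k)%N -> (forall i, w' i.+1 = w i) ->
  \sum_(i < k) f i.+1 (w i) = f 0 (w 0) + pifun k f (w 0) + (lagsum w' 0 - lagsum w 0).
Proof.
move=> k0 w'w; rewrite /pifun addNKr.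
rewrite -(big_mkord xpredT (fun i => f i.+1 (w i))).
rewrite (eq_big_nat _ _ (F2 := fun i => g i.+1 (w i) - g i (w i))); last first.
  by move=> i /andP[_ ik]; exact: f_gfun.
rewrite sumrB [X in _ - X]big_ltn//.
have -> : \sum_(0 <= i < k) g i.+1 (w i) = lagsum w' 0.
  rewrite -(big_add1 _ _ 0 k.+1 xpredT (fun i => g i (w i.-1))) big_nat_recr//=.
  rewrite gfunk addr0; apply: eq_big_nat => -[//|i] _.
  by rewrite subn0 w'w.
have -> : \sum_(1 <= i < k) g i (w i) = lagsum w 0.
  by apply: eq_bigr => i _; rewrite subn0.
by rewrite /gfun opprD opprK addrCA.
Qed.

End Blocks.

(** * Long-run behaviour of the model *)

Section Convergence.
Variable R : realType.

(** Each of the finitely many entries is a telescoping series dominated by a geometric one. *)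
Lemma cvg_geometric_increments m n (z : nat -> 'M[R]_(m, n)) (C g : R) :
  0 <= g < 1 -> (forall i, `|z i.+1 - z i| <= C * g ^+ i) -> cvgn z.
Proof.
move=> /andP[g0 g1] zC.
have cz a b : cvgn (fun i => z i a b).
  pose u i := z i a b.
  have cu : cvgn (series (telescope u)).
    apply: normed_cvg; apply: (@series_le_cvg _ _ (geometric C g)).
    - by move=> i; exact: normr_ge0.
    - by move=> i; exact: le_trans (normr_ge0 _) (zC i).
    - move=> i; apply: le_trans (zC i).
      by have := normmx_entry (z i.+1 - z i) a b; rewrite !mxE.
    - by apply: is_cvg_geometric_series; rewrite ger0_norm.
  have -> : (fun i => z i a b) = cst (u 0) + series (telescope u).
    by apply/funext => i; rewrite -[LHS]/(u i) [in LHS](eq_sum_telescope u).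
  exact: is_cvgD (@is_cvg_cst _ _ _ _ _) cu.
apply/cvg_ex; exists (\matrix_(a, b) limn (fun i => z i a b)).
apply/cvgrPdist_le => e e0.
have cz' a b : \forall i \near \oo, `|limn (fun i => z i a b) - z i a b| <= e.
  by have /cvgrPdist_le/(_ e e0) := cz a b.
have : \forall i \near \oo, forall ab : 'I_m * 'I_n,
    `|limn (fun i => z i ab.1 ab.2) - z i ab.1 ab.2| <= e.
  by apply: filter_forall => ab; exact: cz'.
apply: filterS => i zi; apply: normmx_le => [|a b]; first exact: ltW.
by rewrite !mxE; exact: (zi (a, b)).
Qed.

Lemma continuous_of_lipschitz (V W : normedModType R) (h : V -> W) (L : R) :
  (forall y z, `|h y - h z| <= L * `|y - z|) -> continuous h.
Proof.
move=> hL x; have L1 : 0 < `|L| + 1 by rewrite ltr_wpDl.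
apply/cvgrPdist_le => e e0.
have /cvgrPdist_le/(_ _ (divr_gt0 e0 L1)) : y @[y --> x] --> x by exact: cvg_id.
apply: filterS => y xy.
apply: (le_trans (hL _ _)); rewrite (@le_trans _ _ ((`|L| + 1) * `|x - y|))//.
  by rewrite ler_wpM2r// (le_trans (ler_norm L))// lerDl.
by rewrite mulrC -ler_pdivlMr.
Qed.

Lemma continuous_mulmx m n q (T : 'M[R]_(m, n)) :
  continuous (mulmx T : 'M[R]_(n, q) -> 'M[R]_(m, q)).
Proof.
apply: (continuous_of_lipschitz (L := n%:R * `|T|)) => y z.
by rewrite -mulmxBr normmxM.
Qed.

Lemma mulmx_cvgn m n q (T : 'M[R]_(m, n)) (x : nat -> 'M[R]_(n, q)) l :
  x @ \oo --> l -> (fun i => T *m x i) @ \oo --> T *m l.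
Proof. by apply: continuous_cvg; exact: continuous_mulmx. Qed.

End Convergence.

Section LongRun.
Variables (R : realType) (p k r : nat).
Variables (c : 'cV[R]_p) (f : nat -> 'cV[R]_p -> 'cV[R]_p).
Variables (alpha : 'M[R]_(p, r)) (mu : 'cV[R]_r) (theta : 'cV[R]_p -> 'cV[R]_r).
Variables (f0inv : 'cV[R]_p -> 'cV[R]_p).
Variables (B : set 'M[R]_(p + p * (k - 1), r + p * (k - 1))) (bbar rhobar : R).
Hypothesis k0 : (0 < k)%N.
Hypothesis hMr : @in_Mr R p k f r c alpha mu theta f0inv B bbar rhobar.
Variables (zz : 'I_k -> 'cV[R]_p) (u : 'cV[R]_p).

Let w n := zwin c f f0inv zz u n.
Let Z n : 'cV[R]_(p + p * (k - 1)) := col_mx (f 0 (w n 0)) (zeta k f (w n)).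
Let F (x : 'cV[R]_(p + p * (k - 1))) :=
  btheta k f theta (f0inv (usubmx x)) + bD0 R p k r *m x.
Let mu0 : 'cV[R]_(r + p * (k - 1)) := col_mx mu 0.
Let E n := mu0 + F (Z n).

Let f0K : cancel (f 0) f0inv.
Proof. by case: hMr => _ []. Qed.

Let f0VK : cancel f0inv (f 0).
Proof. by case: hMr => _ []. Qed.

(** The upper block is [sum_f_lagsum] with [c = alpha mu] and [pi = alpha theta], the lower one is
    [zeta_shift]; the impulse enters the upper block alone, between [Z 0] and [Z 1]. *)
Lemma state_step n :
  Z n.+1 = Z n + balpha k alpha *m E n + col_mx (if n == 0%N then u else 0) 0.
Proof.
have [_ _ [cE piE] _ _] := hMr.
have w'w i : w n.+1 i.+1 = w n i by [].
rewrite /E /F /mu0 /Z col_mxKu f0K /btheta /bD0 /balpha.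
rewrite mul_block_col !mul0mx !add0r !add_col_mx addr0 add0r.
rewrite mul_block_col mul0mx add0r mul1mx !add_col_mx addr0.
congr col_mx; last exact: zeta_shift.
have -> : (Emx R p k)^T *m (bgfun k f (w n 0) + Dmx R p k *m zeta k f (w n)) =
    lagsum k f (w n.+1) 0 - lagsum k f (w n) 0.
  rewrite -!(@blockET_zeta R p k f _ 0 (leq0n _)) (zeta_shift k f w'w) [in RHS]mulmxDr.
  by rewrite [RHS]addrAC subrr add0r.
rewrite [LHS]f0VK (sum_f_lagsum f k0 w'w) mulmxDr cE piE.
by rewrite -!addrA [LHS]addrCA.
Qed.

(** The increment of [E] is that of [F], hence [beta^T] times the increment of [Z], which is
    [balpha E]. Indices start at 1 because the step from [Z 0] contains the impulse. *)
Lemma longrun_step n : exists2 M, [set 1%:M + beta^T *m balpha k alpha | beta in B] M &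
  E n.+2 = M *m E n.+1.
Proof.
have [_ _ _ _ [_ /(_ (Z n.+2) (Z n.+1)) [beta Bb FE]]] := hMr.
exists (1%:M + beta^T *m balpha k alpha); first by exists beta.
rewrite mulmxDl mul1mx -mulmxA.
have -> : balpha k alpha *m E n.+1 = Z n.+2 - Z n.+1.
  by rewrite [Z n.+2]state_step /= col_mx0 addr0 [RHS]addrAC subrr add0r.
by rewrite -FE -/(F _) -/(F _) /E -[RHS]addrA [X in _ = _ + X]addrC subrK.
Qed.

Let A := [set 1%:M + beta^T *m balpha k alpha | beta in B].

Lemma longrun_prod n : exists2 P, mxprods A n P & E n.+1 = P *m E 1.
Proof.
elim: n => [|n [P AP EP]]; first by exists 1%:M; rewrite ?mul1mx.
have [M AM EM] := longrun_step n.
exists (M *m P); first by exists M => //; exists P.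
by rewrite EM EP mulmxA.
Qed.

Lemma longrun_stable : stable A.
Proof.
have [[_ rhobar1] _ _ [_ Bb] [jA _]] := hMr.
have [T [rho rho01 Aspec]] := jsr_spec_le rhobar1 jA.
pose b := `|1%:M : 'M[R]_(r + p * (k - 1))| +
  (p + p * (k - 1))%:R * `|bbar| * `|balpha k alpha|.
apply: (berger_wang (b := b) _ _ rho01 Aspec).
  by rewrite addr_ge0// !mulr_ge0.
move=> _ [beta /Bb betab <-].
rewrite (le_trans (ler_normD _ _))// lerD2l (le_trans (normmxM _ _))//.
by rewrite ler_wpM2r// ler_wpM2l// normmx_tr (le_trans betab)// ler_norm.
Qed.

Lemma F_lipschitz x y :
  `|F x - F y| <= (p + p * (k - 1))%:R * `|bbar| * `|x - y|.
Proof.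
have [_ _ _ [_ Bb] [_ /(_ x y)[beta /Bb betab ->]]] := hMr.
rewrite (le_trans (normmxM _ _))// ler_wpM2r// ler_wpM2l// normmx_tr.
by rewrite (le_trans betab)// ler_norm.
Qed.

Lemma zpath_limit q (aperp : 'M[R]_(p, q)) : aperp^T *m alpha = 0 ->
  exists z, [/\ zpath c f f0inv zz u @ \oo --> z, theta z = - mu &
    aperp^T *m hfun k f z =
    aperp^T *m (f 0 (w 0 0) - lagsum k f (w 0) 0) + aperp^T *m u].
Proof.
move=> orth.
have [g /andP[g0 g1] [C AC]] := longrun_stable.
pose C' := (r + p * (k - 1))%:R * `|E 1| * C.
have EC n : `|E n.+1| <= C' * g ^+ n.
  have [P AP ->] := longrun_prod n; rewrite (le_trans (normmxM _ _))//.
  rewrite mulrAC /C' -[leRHS]mulrA ler_wpM2l ?mulr_ge0//; exact: AC.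
have ZC n : `|Z n.+2 - Z n.+1| <= (r + p * (k - 1))%:R * `|balpha k alpha| * C' * g ^+ n.
  rewrite [Z n.+2]state_step /= col_mx0 addr0 addrAC subrr add0r.
  by rewrite (le_trans (normmxM _ _))// -[leRHS]mulrA ler_wpM2l ?mulr_ge0.
have /cvg_ex[/= Zl ZZl] : cvgn (fun n => Z n.+1).
  by apply: (cvg_geometric_increments _ ZC); rewrite g1 ltW.
(* The limit of [E] is computed twice: by continuity of the Lipschitz map [F], and as 0 by geometric
   decay. *)
have FE : F Zl = - mu0.
  have E1 : (fun n => E n.+1) @ \oo --> mu0 + F Zl.
    apply: cvgD; first exact: cvg_cst.
    apply: continuous_cvg ZZl.
    exact: (continuous_of_lipschitz F_lipschitz).
  have E2 : (fun n => E n.+1) @ \oo --> (0 : 'cV[R]_(r + p * (k - 1))).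
    apply/cvgrPdist_le => e e0.
    have : \forall n \near \oo, C' * g ^+ n <= e.
      by apply: geometric_small => //; rewrite g1 ltW.
    by apply: filterS => n; rewrite sub0r normrN; exact: le_trans (EC n).
  have EF : mu0 + F Zl = 0 := cvg_unique (@norm_hausdorff _ _) E1 E2.
  by apply/eqP; rewrite -addr_eq0 addrC EF.
pose z := f0inv (usubmx Zl).
exists z.
have uE q' (x : 'cV[R]_(p + q')) : usubmx x = row_mx 1%:M 0 *m x.
  by rewrite -[x in RHS]vsubmxK mul_row_col mul1mx mul0mx addr0.
have [thz gz] : theta z = - mu /\ bgfun k f z = - (Dmx R p k *m dsubmx Zl).
  move: FE; rewrite /F -/z /btheta /mu0 -[Zl in bD0 _ _ _ _ *m Zl]vsubmxK.
  rewrite /bD0 mul_block_col !mul0mx !add0r add_col_mx addr0 opp_col_mx oppr0.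
  by move=> /eq_col_mx[-> bgD]; split=> //; apply/eqP; rewrite -addr_eq0 bgD.
split=> //.
- have -> : zpath c f f0inv zz u = f0inv \o (fun n => usubmx (Z n.+1)).
    by apply/funext => n /=; rewrite col_mxKu f0K.
  have [_ [_ f0invC _ _] _ _ _] := hMr.
  apply: continuous_cvg; first exact: f0invC.
  by rewrite uE; under eq_fun do rewrite uE; exact: mulmx_cvgn.
(* [T] annihilates [balpha], so [T Z] changes only at the impulse, by [aperp^T u]. *)
pose T := aperp^T *m row_mx 1%:M (- (Emx R p k)^T).
have TE x : T *m x = aperp^T *m (usubmx x - (Emx R p k)^T *m dsubmx x).
  by rewrite -{1}[x]vsubmxK -mulmxA mul_row_col mul1mx mulNmx.
have TZ n : T *m Z n.+1 = T *m Z 0 + aperp^T *m u.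
  have TB : T *m balpha k alpha = 0.
    rewrite -mulmxA mul_row_block !mul1mx mulmx0 mulmx1.
    rewrite [X in row_mx X _]addr0 [X in row_mx _ X]addrN.
    by rewrite mul_mx_row orth mulmx0 row_mx0.
  have Tstep i : T *m Z i.+1 = T *m Z i + aperp^T *m (if i == 0%N then u else 0).
    rewrite state_step mulmxDr [T *m (Z i + _)]mulmxDr.
    rewrite [T *m (_ *m _)]mulmxA TB mul0mx addr0; congr (_ + _).
    by rewrite TE col_mxKu col_mxKd mulmx0 subr0.
  elim: n => [|n IHn]; first exact: Tstep.
  by rewrite Tstep IHn mulmx0 addr0.
have <- : T *m Z 0 = aperp^T *m (f 0 (w 0 0) - lagsum k f (w 0) 0).
  by rewrite TE col_mxKu col_mxKd -(@blockET_zeta R p k f _ 0 (leq0n _)).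
have T1 : (fun n => T *m Z n.+1) @ \oo --> T *m Zl by exact: mulmx_cvgn.
have T2 : (fun n => T *m Z n.+1) @ \oo --> T *m Z 0 + aperp^T *m u.
  by under eq_fun do rewrite TZ; exact: cvg_cst.
have TZl : T *m Zl = T *m Z 0 + aperp^T *m u :=
  cvg_unique (@norm_hausdorff _ _) T1 T2.
(* At the limit [D zeta = - bgfun]; summing the blocks telescopes this to [sum_i g_i = zeta_1],
   which turns [f_0 - zeta_1] into [hfun]. *)
rewrite -TZl TE /hfun -sum_blockET_bgfun gz mulmxN mulmxA sum_blockET_D.
by rewrite mulNmx opprK /z f0VK.
Qed.

End LongRun.

(** * Jacobians under linear substitutions *)

Section Jacobian.
Variable R : realType.

Lemma differentiable_mulmx m n q (T : 'M[R]_(m, n)) (x : 'M[R]_(n, q)) :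
  differentiable (mulmx T) x.
Proof. by apply: linear_differentiable; exact: continuous_mulmx. Qed.

Lemma diff_mulmx m n q (T : 'M[R]_(m, n)) (x : 'M[R]_(n, q)) :
  'd (mulmx T) x = mulmx T :> ('M[R]_(n, q) -> 'M[R]_(m, q)).
Proof. by apply: diff_lin; exact: continuous_mulmx. Qed.

Lemma diff_cjacobian m n (h : 'cV[R]_n -> 'cV[R]_m) x v :
  'd h x v = cjacobian h x *m v.
Proof.
apply/colP => i; rewrite mxE.
have {1}-> : v = \sum_j v j 0 *: delta_mx j 0.
  apply/colP => j; rewrite summxE (bigD1 j)//= big1 => [|l lj].
    by rewrite !mxE !eqxx mulr1 addr0.
  by rewrite !mxE eq_sym (negbTE lj) mulr0.
rewrite linear_sum summxE; apply: eq_bigr => j _.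
by rewrite linearZ !mxE mulrC.
Qed.

Lemma differentiable_mulmx_comp m n q (h : 'cV[R]_n -> 'cV[R]_m) (T : 'M[R]_(n, q)) :
  differentiable h 0 -> differentiable (fun u => h (T *m u)) 0.
Proof.
move=> dh; apply: (@differentiable_comp _ _ _ _ (mulmx T) h).
  exact: differentiable_mulmx.
by rewrite mulmx0.
Qed.

Lemma cjacobian_mulmx_comp m n q (h : 'cV[R]_n -> 'cV[R]_m) (T : 'M[R]_(n, q)) :
  differentiable h 0 ->
  cjacobian (fun u => h (T *m u)) 0 = cjacobian h 0 *m T.
Proof.
move=> dh; apply/matrixP => i j.
rewrite /cjacobian mxE (_ : (fun u => h (T *m u)) = h \o mulmx T)//.
rewrite diff_comp ?mulmx0//; last exact: differentiable_mulmx.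
rewrite /= diff_mulmx diff_cjacobian mulmxA -colE !mxE.
by apply: eq_bigr => l _; rewrite !mxE.
Qed.

End Jacobian.

Theorem theorem4p2 (R : realType) (p k r : nat)
  (hp : (1 <= p)%N) (hk : (1 <= k)%N) (hr : (r < p)%N)
  (c : 'cV[R]_p) (f : nat -> 'cV[R]_p -> 'cV[R]_p)
  (hf0 : forall i, (i <= k)%N -> f i 0 = 0)
  (alpha : 'M[R]_(p, r)) (mu : 'cV[R]_r) (theta : 'cV[R]_p -> 'cV[R]_r)
  (f0inv : 'cV[R]_p -> 'cV[R]_p)
  (B : set 'M[R]_(p + p * (k - 1), r + p * (k - 1))) (bbar rhobar : R)
  (hMr : @in_Mr R p k f r c alpha mu theta f0inv B bbar rhobar)
  (alpha_perp : 'M[R]_(p, p - r))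
  (hperp_rank : \rank alpha_perp = (p - r)%N)
  (hperp_orth : alpha_perp^T *m alpha = 0)
  (chiinv : 'cV[R]_(p - r + r) -> 'cV[R]_p)
  (hchiK : forall z, chiinv (col_mx (alpha_perp^T *m hfun k f z) (theta z)) = z)
  (hchiVK : forall w,
     col_mx (alpha_perp^T *m hfun k f (chiinv w)) (theta (chiinv w)) = w) :
  let psi := fun z : 'cV[R]_p => alpha_perp^T *m hfun k f z in
  let Mmu := [set z : 'cV[R]_p | theta z = - mu] in
  let vmap := fun (z : 'cV[R]_p) (v : 'cV[R]_(p - r)) =>
                chiinv (col_mx (psi z + v) (- mu)) in
  let N := [set z | Mmu z /\ ~ differentiable (vmap z) 0] in
  let N0 := N `|` [set z | Mmu z /\ ~ N z /\
              ~ (exists L : 'M[R]_(p - r, p), L *m cjacobian (vmap z) 0 = 1%:M)] in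
  let Theta_inf := fun z : 'cV[R]_p =>
        cjacobian (fun u : 'cV[R]_p => chiinv (col_mx (psi z + alpha_perp^T *m u) (- mu))) 0 in
  [set cjacobian (zinf c f f0inv zz) 0 | zz in [set zz : 'I_k -> 'cV[R]_p | lr_jacobian_exists c f f0inv zz]]
    = Theta_inf @` (Mmu `\` N)
  /\ (forall z, (Mmu `\` N0) z -> \rank (Theta_inf z) = (p - r)%N).
Proof.
move=> psi Mmu vmap N N0 Theta_inf.
(* The conserved quantity read off the initial window, before the impulse; [w] is [zwin] at step
   0. *)
pose a (zz : 'I_k -> 'cV[R]_p) :=
  let w := fun j => oapp zz 0 (insub j) in
  alpha_perp^T *m (f 0 (w 0%N) - lagsum k f w 0).
have zpath_cvg zz u :
    zpath c f f0inv zz u @ \oo --> chiinv (col_mx (a zz + alpha_perp^T *m u) (- mu)).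
  have [z [zz_z thz psiz]] := zpath_limit hk hMr zz u hperp_orth.
  by rewrite -[z]hchiK thz psiz in zz_z.
have zinfE zz : zinf c f f0inv zz =
    fun u => chiinv (col_mx (a zz + alpha_perp^T *m u) (- mu)).
  by apply/funext => u; apply: cvg_lim; [exact: norm_hausdorff|exact: zpath_cvg].
(* This right inverse recovers the map of [v] from that of [u = pinvmx alpha_perp^T *m v]. *)
have perpK : alpha_perp^T *m pinvmx alpha_perp^T = 1%:M.
  by apply: mulmxVp; rewrite /row_free mxrank_tr hperp_rank.
split; last first.
  move=> z [zM zN0].
  have dz : differentiable (vmap z) 0.
    by apply: contrapT => nd; apply: zN0; left.
  have [L LJ] : exists L, L *m cjacobian (vmap z) 0 = 1%:M.
    apply: contrapT => nL; apply: zN0; right; split=> //; split=> //.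
    by move=> [_].
  have ThE : Theta_inf z = cjacobian (vmap z) 0 *m alpha_perp^T.
    exact: (cjacobian_mulmx_comp alpha_perp^T dz).
  apply/eqP; rewrite eqn_leq; apply/andP; split.
    by rewrite ThE (leq_trans (mxrankM_maxr _ _))// mxrank_tr hperp_rank.
  (* The left inverse [L] cancels the Jacobian: [alpha_perp^T] is [L] times [Theta_inf z]. *)
  rewrite -[leqLHS]hperp_rank -mxrank_tr -[alpha_perp^T]mul1mx -LJ -mulmxA -ThE.
  exact: mxrankM_maxr.
apply/seteqP; split=> [_ [zz [_ dz] <-]|_ [z [zM zN] <-]].
  (* The steady state attached to a window is its limit for [u = 0]. *)
  exists (chiinv (col_mx (a zz) (- mu))); last first.
    rewrite zinfE /Theta_inf /psi.
    by have /eq_col_mx[-> _] := hchiVK (col_mx (a zz) (- mu)).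
  have /eq_col_mx[psiE thE] := hchiVK (col_mx (a zz) (- mu)).
  split=> // -[_]; apply.
  have -> : vmap (chiinv (col_mx (a zz) (- mu))) =
      fun v => zinf c f f0inv zz (pinvmx alpha_perp^T *m v).
    by apply/funext => v; rewrite zinfE mulmxA perpK mul1mx /vmap /psi psiE.
  exact: differentiable_mulmx_comp.
have dz : differentiable (vmap z) 0 by apply: contrapT => nd; apply: zN.
(* The constant window at [z] realises every [z] in [Mmu]: its lag sum is the sum of the [g_i z].
   Indices stay below [k], so the default 0 of the window is never read. *)
have aE : a (fun=> z) = psi z.
  have wE j : (j < k)%N -> oapp (fun=> z) 0 (insub j : option 'I_k) = z.
    by move=> jk; rewrite insubT.
  rewrite /a /psi /hfun /lagsum wE//; congr (_ *m (_ - _)).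
  by apply: eq_big_nat => i /andP[_ ik]; rewrite subn0 wE.
exists (fun=> z); last by rewrite zinfE aE.
split; first by near=> u; apply/cvg_ex; eexists; exact: zpath_cvg.
rewrite zinfE aE; exact: (differentiable_mulmx_comp alpha_perp^T dz).
Unshelve. all: by end_near. Qed.
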